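(* For $1\le j\le N$ let $\Omega_j$ be a compact subset of $\mathbb C$ supporting a non-atomic finite measure $m_j$ satisfying condition (A) with exponent $\delta_j$, and let $\Omega=\Omega_1\times\dots\times\Omega_N\subseteq\mathbb C^N$. Then for every $N$-tuple $(i_1,\dots,i_N)$ with $i_j\ge0$ and $\sum_j i_j=1$, $$\dim\big(\mathrm{Bad}_{\mathbb C}(i_1,\dots,i_N)\cap\Omega\big)=\dim\Omega.$$
   Context: $\dim$ is Hausdorff dimension ($\mathbb C$ with the usual metric, $\mathbb C^N$ with the maximum of the coordinate metrics). Condition (A) with exponent $\delta$ for $\mu$ supported on compact $\Omega'\subseteq\mathbb C$: there are $r_0>0$, $0<a\le1\le b$ with $ar^\delta\le\mu(B(c,r))\le br^\delta$ for $c\in\Omega'$, $r\le r_0$. $\mathbb Z[i]$ is the ring of Gaussian integers. $\mathrm{Bad}_{\mathbb C}(i_1,\dots,i_N)$ is the set of $z=(z_1,\dots,z_N)\in\mathbb C^N$ for which there is $c(z)>0$ such that for all $q,p_1,\dots,p_N\in\mathbb Z[i]$ with $q\ne0$, $\max\{|qz_1-p_1|^{1/i_1},\dots,|qz_N-p_N|^{1/i_N}\}\ge c(z)|q|^{-1}$, where terms with $i_s=0$ are omitted from the maximum. *)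

(* Defs.v *)
From HB Require Import structures.
From mathcomp Require Import all_boot all_order all_algebra.
From mathcomp Require Import all_classical all_reals all_analysis.
Set Implicit Arguments. Unset Strict Implicit. Unset Printing Implicit Defensive.
Import Order.TTheory GRing.Theory Num.Theory.
Import numFieldNormedType.Exports.
Local Open Scope classical_set_scope.
Local Open Scope ring_scope.

(** * The complex plane, modelled as R * R (so that it carries the product
    = Borel sigma-algebra and the product topology of MathComp-Analysis). *)
Notation C R := (R * R)%type.

Section Complex.
Variable R : realType.
Definition cmul (z w : C R) : C R := (z.1 * w.1 - z.2 * w.2, z.1 * w.2 + z.2 * w.1).
Definition csub (z w : C R) : C R := (z.1 - w.1, z.2 - w.2).
Definition cnorm (z : C R) : R := Num.sqrt (z.1 ^+ 2 + z.2 ^+ 2).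
Definition cdist (z w : C R) : R := cnorm (csub z w).
Definition gauss_int (q : C R) : Prop := exists a b : int, q = (a%:~R, b%:~R).
Definition cball (c : C R) (r : R) : set (C R) := [set z | cdist z c <= r].
Definition distCN (N : nat) (z w : 'I_N -> C R) : R :=
  \big[Num.max/0]_(j < N) cdist (z j) (w j).
End Complex.

Section Hausdorff.
Variables (R : realType) (T : Type) (d : T -> T -> R).
Local Open Scope ereal_scope.

(** diameter (the diameter of the empty set is taken to be 0) *)
Definition diam (U : set T) : \bar R :=
  ereal_sup ([set 0%E] `|` [set (d xy.1 xy.2)%:E | xy in U `*` U]).

Definition hterm (s : R) (U : set T) : \bar R :=
  if U == set0 then 0%E else ((fine (diam U)) `^ s)%:E.

Definition haus_content (s delta : R) (A : set T) : \bar R :=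
  ereal_inf [set \sum_(i <oo) hterm s (F i) | F in
    [set F : nat -> set T | A `<=` \bigcup_i F i /\ forall i, diam (F i) <= delta%:E]].

Definition hausdorff_measure (s : R) (A : set T) : \bar R :=
  ereal_sup [set haus_content s delta A | delta in [set delta : R | (0 < delta)%R]].

Definition hausdorff_dim (A : set T) : \bar R :=
  ereal_inf [set s%:E | s in [set s : R | (0 <= s)%R /\ hausdorff_measure s A = 0]].
End Hausdorff.

Definition condA (R : realType) (mu : {measure set (C R) -> \bar R})
    (Om : set (C R)) (delta : R) : Prop :=
  exists r0 a b : R, [/\ 0 < r0, 0 < a, a <= 1, 1 <= b &
    forall c r, Om c -> 0 < r -> r <= r0 ->
      ((a * r `^ delta)%:E <= mu (cball c r))%E /\
      (mu (cball c r) <= (b * r `^ delta)%:E)%E].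

Definition BadC (R : realType) (N : nat) (i : 'I_N -> R) : set ('I_N -> C R) :=
  [set z | exists2 c : R, 0 < c &
    forall (q : C R) (p : 'I_N -> C R), gauss_int q -> (forall s, gauss_int (p s)) ->
      q <> (0, 0) ->
      c * (cnorm q)^-1 <=
        \big[Num.max/0]_(s < N | i s != 0) (cnorm (csub (cmul q (z s)) (p s))) `^ (i s)^-1].

(* Main.v *)
(* All rectangles are products of discs centred in [Om]; those of level [n] have radii
   [rho n j = s k^(-n(1 + i j))].  The rationals [p / q] with [k^n <= |q| <= k^(n+1)] close to a
   rectangle of level [n] lie on one complex hyperplane: otherwise a determinant of Gaussian
   integers would be nonzero and smaller than 1.  In the coordinate that dominates the equation of
   the hyperplane, the children of the rectangle meeting a dangerous neighbourhood are confined to a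
   disc of radius [O(rho n j / k)], so that condition (A) makes at least half of all children safe,
   and a fraction of the volume bounded below independently of [k] survives.
   A cover of [BadC i] and [Omega] of small [t]-content, [t < \sum_j delta j], is defeated without
   building a measure: the sum over the cover of the relative masses, weighted by the losses still to
   come, does not increase on average over the safe children, hence stays below the value it would
   have if the current rectangle met a covering set of its own size.  The limit of the chosen
   rectangles is badly approximable and not covered. *)
Require Import Defs.
From HB Require Import structures.
From mathcomp Require Import all_boot all_order all_algebra.
From mathcomp Require Import all_classical all_reals all_analysis.
From mathcomp Require Import measurable_realfun perm complex ring lra zify.
Import Order.TTheory GRing.Theory Num.Theory.
Import numFieldNormedType.Exports.
Set Implicit Arguments. Unset Strict Implicit. Unset Printing Implicit Defensive.
Local Open Scope classical_set_scope.
Local Open Scope ring_scope.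
Import Normc.

(** * Gaussian integers, determinants and common hyperplanes *)

Section Simplex.
Variable R : realType.
Implicit Types (n : nat).

Lemma normc_sum (I : Type) (r : seq I) (P : pred I) (F : I -> R[i]) :
  normc (\sum_(k <- r | P k) F k) <= \sum_(k <- r | P k) normc (F k).
Proof.
elim/big_ind2 : _ => [|x1 x2 y1 y2 h1 h2|//]; first by rewrite normc0.
by apply: le_trans (le_normcD _ _) _; apply: lerD.
Qed.

Lemma normc_prod (I : Type) (r : seq I) (P : pred I) (F : I -> R[i]) :
  normc (\prod_(k <- r | P k) F k) = \prod_(k <- r | P k) normc (F k).
Proof. by apply: (big_morph _ (@normcM R) (@normc1 R)). Qed.

Lemma normc_ge0 (x : R[i]) : 0 <= normc x.
Proof. by case: x => a b; rewrite /normc sqrtr_ge0. Qed.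

(** In the Leibniz expansion each of the [n!] terms takes one entry from every column. The bounds
    depend on the column only, so all terms share the same bound. *)
Lemma normc_det_le n (A : 'M[R[i]]_n) (h : 'I_n -> R) :
  (forall i j, normc (A i j) <= h j) ->
  normc (\det A) <= n`!%:R * \prod_j h j.
Proof.
move=> hA; apply: le_trans (normc_sum _ _ _) _.
have -> : n`!%:R * \prod_j h j = \sum_(s : 'S_n) \prod_j h j.
  rewrite mulr_natl sumr_const; congr (_ *+ _).
  by rewrite -[LHS]card_Sn; apply: eq_card.
apply: ler_sum => s _; rewrite normcM.
have -> : normc ((-1) ^+ s : R[i]) = 1.
  case: (odd_perm s); rewrite ?expr1 ?expr0 ?normc1//.
  by rewrite (normcN (1 : Rcomplex R)) normc1.
rewrite mul1r normc_prod [leRHS](reindex_inj (@perm_inj _ s)) /=.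
by apply: ler_prod => j _; rewrite normc_ge0 hA.
Qed.

Definition gaussian (z : R[i]) := exists a b : int, z = (a%:~R +i* b%:~R)%C.

Lemma gaussianD x y : gaussian x -> gaussian y -> gaussian (x + y).
Proof.
by move=> [a [b ->]] [c [d ->]]; exists (a + c), (b + d); rewrite !rmorphD.
Qed.

Lemma gaussianM x y : gaussian x -> gaussian y -> gaussian (x * y).
Proof.
move=> [a [b ->]] [c [d ->]]; exists (a * c - b * d), (a * d + b * c).
by rewrite !rmorphD rmorphN !rmorphM.
Qed.

Lemma gaussian0 : gaussian 0.
Proof. by exists 0, 0; rewrite !mulr0z. Qed.

Lemma gaussian1 : gaussian 1.
Proof. by exists 1, 0; rewrite mulr0z mulr1z. Qed.

Lemma gaussianN x : gaussian x -> gaussian (- x).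
Proof. by move=> [a [b ->]]; exists (- a), (- b); rewrite !rmorphN. Qed.

Lemma gaussian_det n (A : 'M[R[i]]_n) :
  (forall i j, gaussian (A i j)) -> gaussian (\det A).
Proof.
move=> gA; apply: (big_ind gaussian) => [||s _]; first exact: gaussian0.
  exact: gaussianD.
apply: gaussianM.
  by case: (odd_perm s); rewrite ?expr1 ?expr0;
    [apply: gaussianN|]; exact: gaussian1.
by apply: (big_ind gaussian) => //; [exact: gaussian1|exact: gaussianM].
Qed.

(** The squared modulus is a nonnegative integer. This is what turns a small determinant into a
    vanishing one. *)
Lemma gaussian_norm_lt1 x : gaussian x -> normc x < 1 -> x = 0.
Proof.
move=> [a [b ->]]; rewrite /normc => h.
have h2 : (a%:~R ^+ 2 + b%:~R ^+ 2 : R) < 1.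
  rewrite -[X in X < _]sqr_sqrtr ?addr_ge0 ?sqr_ge0//.
  by rewrite expr_lt1 // sqrtr_ge0.
have : a ^+ 2 + b ^+ 2 < 1 by rewrite -(ltr_int R) rmorphD /= !rmorphXn.
move=> h3.
have a0 : a = 0 by apply/eqP; rewrite -sqrf_eq0; have := sqr_ge0 a; have := sqr_ge0 b; lia.
have b0 : b = 0 by apply/eqP; rewrite -sqrf_eq0; have := sqr_ge0 a; have := sqr_ge0 b; lia.
by rewrite a0 b0 mulr0z.
Qed.

End Simplex.

(** [V] may be infinite, so a matrix with rows in [V] of maximal rank is taken. Its row space
    contains all of [V], and it is proper because full rank would give a nonzero determinant; a
    kernel vector is then the normal of the hyperplane. *)
Lemma common_hyperplane (K : fieldType) n (V : 'rV[K]_n -> Prop) :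
  (forall A : 'M[K]_n, (forall i, V (row i A)) -> \det A = 0) ->
  exists2 u : 'cV[K]_n, u != 0 & forall v, V v -> v *m u = 0.
Proof.
move=> hV.
pose P r := `[< exists k (A : 'M[K]_(k, n)), (forall i, V (row i A)) /\ \rank A = r >].
have exP : exists r, P r.
  exists 0; apply/asboolP; exists 0, 0; split; first by case.
  by rewrite mxrank0.
have ubP r : P r -> (r <= n)%N.
  by move=> /asboolP[k [A [_ <-]]]; exact: rank_leq_col.
case: (ex_maxnP exP ubP) => r /asboolP[k [A [VA rA]]] maxr.
have VsubA v : V v -> (v <= A)%MS.
  move=> Vv; apply: contraT => nvA.
  have : (\rank (col_mx A v) <= r)%N.
    apply: maxr; apply/asboolP; exists (k + 1)%N, (col_mx A v); split=> // i.
    case: (split_ordP i) => j ->; first by rewrite rowKu.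
    by rewrite rowKd (ord1 j) (_ : row 0 v = v) //; apply/rowP => l; rewrite mxE.
  have ltA : (A < col_mx A v)%MS.
    by rewrite ltmxE -!(addsmxE A v) addsmxSl /= addsmx_sub submx_refl /= nvA.
  by rewrite -rA leqNgt (rank_ltmx ltA).
have rn : (\rank A < n)%N.
  rewrite ltnNge; apply/negP => nr.
  have fA : row_full A by rewrite /row_full eqn_leq nr rank_leq_col.
  (* A matrix of full column rank contains [n] independent rows, which form an invertible square
     matrix with rows in [V]. *)
  have : \det (rowsub (fullrankfun fA) A) = 0.
    by apply: hV => i; rewrite row_rowsub.
  apply/eqP; rewrite -unitfE -[_ \is a GRing.unit]/(_ \in unitmx).
  by rewrite -row_free_unit /row_free mxrank_fullrowsub.
have : kermx A^T != 0.
  by rewrite -mxrank_eq0 mxrank_ker mxrank_tr subn_eq0 -ltnNge.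
case/rowV0Pn => w /sub_kermxP wA w0.
exists w^T; first by rewrite trmx_eq0.
move=> v /VsubA /submxP[B ->].
by apply: trmx_inj; rewrite !trmx_mul trmxK mulmxA wA mul0mx trmx0.
Qed.

Import Normc.

(** * Rational points close to one centre *)

Section Resonant.
Variable R : realType.

(** The pair [(q, p)] gives homogeneous coordinates of the point [p / q]. Nothing is known of [p j]
    outside [I], hence the demand that [a] vanish there, so that the equation only involves the
    controlled coordinates. *)
Lemma resonant_hyperplane N (I : pred 'I_N) (c : 'I_N -> R[i]) (h : 'I_N -> R)
    (H : R) (V : R[i] -> ('I_N -> R[i]) -> Prop) :
  1 <= H -> (forall j, 0 <= h j) ->
  (forall q p, V q p -> [/\ gaussian q, forall j, gaussian (p j), q != 0,
      normc q <= H & forall j, I j -> normc (p j - q * c j) <= h j]) ->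
  (N.+1)`!%:R * (H * \prod_(j < N | I j) h j) < 1 ->
  exists (b : R[i]) (a : 'I_N -> R[i]),
    [/\ forall j, ~~ I j -> a j = 0,
        (exists q p, V q p) -> exists j, a j != 0 &
        forall q p, V q p -> b * q + \sum_j a j * p j = 0].
Proof.
move=> H1 h0 hV small.
pose vec (q : R[i]) (p : 'I_N -> R[i]) : 'rV[R[i]]_(1 + N) :=
  row_mx q%:M (\row_j (if I j then p j else 0)).
(* The unit vectors outside [I] force [a] to vanish there; the shear [U] below recentres the columns
   in [I] at [c], which makes the determinant small without changing it. *)
pose W (v : 'rV[R[i]]_(1 + N)) :=
  (exists q p, V q p /\ v = vec q p) \/
  (exists j, ~~ I j /\ v = row_mx 0 (delta_mx 0 j)).
pose U : 'M[R[i]]_(1 + N) :=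
  block_mx 1%:M (\row_j (if I j then - c j else 0)) 0 1%:M.
(* Column bounds after the shear: [H] for the denominators, [h j] for recentred numerators, 1 for
   the unit vectors. *)
pose h' (k : 'I_(1 + N)) : R :=
  match fintype.split k with inl _ => H | inr j => if I j then h j else 1 end.
have detU : \det U = 1 by rewrite det_ublock !det1 mulr1.
have Wgauss v k : W v -> gaussian (v 0 k).
  case=> [[q [p [Vqp ->]]]|[j [_ ->]]].
    have [gq gp _ _ _] := hV _ _ Vqp.
    rewrite mxE; case: (fintype.split k) => l; rewrite !mxE ?(ord1 l) ?eqxx //.
    by case: ifP => _ //; exact: gaussian0.
  rewrite mxE; case: (fintype.split k) => l; rewrite !mxE; first exact: gaussian0.
  by case: (_ && _); [exact: gaussian1|exact: gaussian0].
have Wh v k : W v -> normc ((v *m U) 0 k) <= h' k.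
  case=> [[q [p [Vqp ->]]]|[j [nIj ->]]]; rewrite mul_row_block !mulmx0 !mulmx1 ?mul0mx ?add0r ?addr0.
    have [_ _ _ qH ph] := hV _ _ Vqp.
    rewrite mxE /h'; case: (fintype.split k) => l; rewrite !mxE ?(ord1 l) ?eqxx //.
    rewrite big_ord1 !mxE eqxx mulr1n.
    case: ifP => Il; first by rewrite mulrN addrC; exact: ph.
    by rewrite mulr0 addr0 normc0 ler01.
  rewrite mxE /h'; case: (fintype.split k) => l; rewrite !mxE ?normc0; first exact: le_trans H1.
  rewrite eqxx /=; case: (eqVneq l j) => [->|_].
    by rewrite (negbTE nIj) normc1.
  by rewrite normc0; case: ifP.
have prodh : \prod_k h' k = H * \prod_(j < N | I j) h j.
  rewrite big_split_ord /= big_ord1; congr (_ * _).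
    by rewrite /h'; case: split_ordP => // j /eqP; rewrite eq_lrshift.
  rewrite [RHS]big_mkcond /=; refine (eq_bigr _ _) => j _.
  rewrite /h'; case: split_ordP => [l /eqP|l]; first by rewrite eq_rlshift.
  by move=> /rshift_inj ->.
have detW (A : 'M[R[i]]_(1 + N)) : (forall k, W (row k A)) -> \det A = 0.
  move=> WA; apply: gaussian_norm_lt1.
    by apply: gaussian_det => k l; have := Wgauss _ l (WA k); rewrite mxE.
  rewrite -[\det A]mulr1 -detU -det_mulmx.
  apply: le_lt_trans small; rewrite -prodh; apply: normc_det_le => k l.
  by have := Wh _ l (WA k); rewrite -row_mul mxE.
have [u u0 Wu] := common_hyperplane detW.
exists (u (lshift N 0) 0), (fun j => u (rshift 1 j) 0).
have aI j : ~~ I j -> u (rshift 1 j) 0 = 0.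
  move=> nIj; have : W (row_mx 0 (delta_mx 0 j)) by right; exists j.
  move/Wu; rewrite -(vsubmxK u) mul_row_col mul0mx add0r -rowE => /rowP/(_ 0).
  by rewrite !mxE; case: split_ordP => [l /eqP|l /rshift_inj <-]; rewrite ?eq_rlshift // mxE.
have eqV q p : V q p -> u (lshift N 0) 0 * q + \sum_j u (rshift 1 j) 0 * p j = 0.
  move=> Vqp; have : W (vec q p) by left; exists q, p.
  move/Wu/rowP/(_ 0); rewrite mxE [RHS]mxE big_split_ord big_ord1 /= => e.
  rewrite -[RHS]e; congr (_ + _); first by rewrite row_mxEl mxE eqxx mulr1n mulrC.
  apply: eq_bigr => j _; rewrite row_mxEr mxE.
  by case: ifP => Ij; rewrite 1?mulrC // aI ?Ij // mul0r mulr0.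
split=> //.
(* If every [a j] were 0, the equation at one point would read [b * q = 0] with [q != 0], and the
   normal [u] would vanish. *)
move=> [q [p Vqp]]; apply/existsP; apply: contraT; rewrite negb_exists => /forallP /= hu.
have a0 j : u (rshift 1 j) 0 = 0 by apply/eqP; have := hu j; rewrite negbK.
have := eqV _ _ Vqp; rewrite big1 ?addr0; last by move=> j _; rewrite a0 mul0r.
have [_ _ q0 _ _] := hV _ _ Vqp.
move/eqP; rewrite mulf_eq0 (negbTE q0) orbF => /eqP b0.
case/negP: u0; apply/eqP/colP => k; rewrite [RHS]mxE.
by case: (split_ordP k) => l ->; rewrite ?(ord1 l).
Qed.

End Resonant.

(** * The plane identified with the complex field *)

Section Plane.
Variable R : realType.
Implicit Types z w : C R.

(** The passage to [R[i]], where division and determinants are available. *)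
Definition toc z : R[i] := (z.1 +i* z.2)%C.

Lemma cnormE z : cnorm z = normc (toc z).
Proof. by []. Qed.

Lemma toc_sub z w : toc (csub z w) = toc z - toc w.
Proof. by []. Qed.

Lemma toc_mul z w : toc (cmul z w) = toc z * toc w.
Proof. by []. Qed.

Lemma toc_inj : injective toc.
Proof. by move=> [a b] [c d] [-> ->]. Qed.

Lemma cdistE z w : cdist z w = normc (toc z - toc w).
Proof. by []. Qed.

Lemma normcB (x y : R[i]) : normc (x - y) = normc (y - x).
Proof. by rewrite -(normcN (x - y : Rcomplex R)) opprB. Qed.

Lemma cdistC z w : cdist z w = cdist w z.
Proof. by rewrite !cdistE normcB. Qed.

Lemma cdist_ge0 z w : 0 <= cdist z w.
Proof. exact: sqrtr_ge0. Qed.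

Lemma cdistxx z : cdist z z = 0.
Proof. by rewrite cdistE subrr normc0. Qed.

Lemma cdist_triangle u z w : cdist z w <= cdist z u + cdist u w.
Proof.
rewrite !cdistE (_ : toc z - toc w = (toc z - toc u) + (toc u - toc w)).
  exact: le_normcD.
by rewrite addrA subrK.
Qed.

Lemma cnorm_cmulB (q z p : C R) : q <> (0, 0) ->
  cnorm (csub (cmul q z) p) = cnorm q * normc (toc z - toc p / toc q).
Proof.
move=> q0; have nq : toc q != 0 by apply/eqP => h; apply: q0; apply: toc_inj.
rewrite !cnormE toc_sub toc_mul -normcM; congr normc.
by rewrite mulrBr [toc p / _]mulrC mulVKf.
Qed.

Lemma gauss_int_toc z : gauss_int z -> gaussian (toc z).
Proof. by move=> [a [b ->]]; exists a, b. Qed.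

Lemma gauss_int_norm_ge1 z : gauss_int z -> z <> (0, 0) -> 1 <= cnorm z.
Proof.
move=> /gauss_int_toc gz z0; rewrite leNgt; apply/negP => h.
by apply: z0; apply: toc_inj; exact: gaussian_norm_lt1.
Qed.

End Plane.

Import Normc.

Lemma powR_addr (R : realType) (a x y : R) : 0 < a -> a `^ (x + y) = a `^ x * a `^ y.
Proof. by move=> a0; rewrite powRD ?(gt_eqF a0)?implybT. Qed.

(** * Scales, dangerous neighbourhoods and their confinement *)

Section Scales.
Variables (R : realType) (N : nat) (i : 'I_N -> R) (k s : R).

Definition ratio (j : 'I_N) : R := k `^ (- (1 + i j)).
Definition radius (n : nat) (j : 'I_N) : R := s * ratio j ^+ n.

(** After division by [|q|]: in every coordinate of positive weight, [z j] is within
    [radius n j / k] of [p j / q]. As [|q|] is of the order of [k^n], escaping this at all levels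
    implies bad approximability. *)
Definition danger (n : nat) (z : 'I_N -> C R) : Prop :=
  exists (q : C R) (p : 'I_N -> C R),
    [/\ gauss_int q, forall j, gauss_int (p j), q <> (0, 0),
        k ^+ n <= cnorm q <= k ^+ n.+1 &
        forall j, i j != 0 ->
          cnorm (csub (cmul q (z j)) (p j)) <= cnorm q * (radius n j / k)].

(** [x] is the centre of the parent and [x'] that of the child. Asking [z] to lie in the parent too
    keeps [p / q] near [x], so that one hyperplane serves all children. *)
Definition meets_danger (n : nat) (x x' : 'I_N -> C R) : Prop :=
  exists z, [/\ forall j, cdist (z j) (x' j) <= radius n.+1 j,
                forall j, cdist (z j) (x j) <= radius n j & danger n z].

Hypotheses (k1 : 1 < k) (s0 : 0 < s) (i0 : forall j, 0 <= i j).
Hypothesis i1 : \sum_j i j = 1.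

Let k0 : 0 < k. Proof. exact: lt_trans k1. Qed.

Lemma ratio_gt0 j : 0 < ratio j.
Proof. exact: powR_gt0. Qed.

Lemma ratio_le j : ratio j <= k^-1.
Proof.
rewrite /ratio -[k^-1](powR_inv1 (ltW k0)) ler_powR ?(ltW k1)//.
by rewrite lerN2 lerDl.
Qed.

Lemma radius_gt0 n j : 0 < radius n j.
Proof. by rewrite mulr_gt0 ?exprn_gt0 ?ratio_gt0. Qed.

Lemma radiusS n j : radius n.+1 j = radius n j * ratio j.
Proof. by rewrite /radius exprSr mulrA. Qed.

Lemma radiusS_le n j : radius n.+1 j <= radius n j / k.
Proof. by rewrite radiusS ler_wpM2l ?ratio_le// ltW ?radius_gt0. Qed.

Lemma exists_weight : exists j, i j != 0.
Proof.
apply/existsP; apply: contraT; rewrite negb_exists => /forallP h.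
have := i1; rewrite big1 => [/eqP|j _]; first by rewrite eq_sym oner_eq0.
by apply/eqP; have := h j; rewrite negbK.
Qed.

Lemma prod_ratio : \prod_(j < N | i j != 0) (k * ratio j) = k^-1.
Proof.
have kr j : k * ratio j = k `^ (- i j).
  by rewrite /ratio opprD powR_addr // powR_inv1 ?ltW// mulVKf // gt_eqF.
under eq_bigr do rewrite kr.
rewrite -[RHS]powR_inv1 ?ltW// -i1 -sumrN [in RHS](bigID (fun j => i j != 0)) /=.
rewrite [X in _ `^ (_ + X)]big1 ?addr0; last first.
  by move=> j; rewrite negbK => /eqP ->; rewrite oppr0.
apply: (big_ind2 (fun a b => a = k `^ b)) => //; first by rewrite powRr0.
by move=> a b c d -> ->; rewrite powR_addr.
Qed.

(* The total weight [\sum_j i j = 1] makes the volume of the rectangle exactly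
   balance the size of the denominators, whatever the level [n]. *)
Lemma prod_radius_le n : 2 * s * k <= 1 ->
  k ^+ n.+1 * \prod_(j < N | i j != 0) (k ^+ n.+1 * (2 * radius n j)) <= 2 * s * k ^+ 2.
Proof.
move=> sk.
have -> : \prod_(j < N | i j != 0) (k ^+ n.+1 * (2 * radius n j)) =
    (\prod_(j < N | i j != 0) (2 * s * k)) * (k ^-1) ^+ n.
  rewrite -prod_ratio -prodrXl -big_split; apply: eq_bigr => j _ /=.
  by rewrite /radius exprMn exprS; ring.
have [j1 ij1] := exists_weight.
have h : \prod_(j < N | i j != 0) (2 * s * k) <= 2 * s * k.
  rewrite (bigD1 j1) //= ler_piMr ?mulr_ge0 ?(ltW s0) ?(ltW k0)//.
  apply: prodr_ile1 => j _; rewrite sk andbT.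
  by rewrite !mulr_ge0 ?ltW.
rewrite exprVn exprS [X in _ * X]mulrC mulrA mulfK ?expf_neq0 ?gt_eqF//.
by rewrite expr2 mulrA mulrC ler_wpM2r // ltW.
Qed.

(** All rationals involved satisfy one equation [b + \sum_j a j * (p j / q) = 0]. The centre of a
    dangerous child is within [2 * radius n j / k] of such a rational in each relevant coordinate,
    so it solves the equation up to [2 * N / k] times the largest [|a j| * radius n j]. Subtracting
    two such relations for centres differing in [j0] alone and dividing by [|a j0|] gives the
    bound. *)
Lemma danger_confined n x : (N.+1)`!%:R * (2 * s * k ^+ 2) < 1 ->
  exists j0, forall x' y',
    (forall j, j != j0 -> x' j = y' j) ->
    meets_danger n x x' -> meets_danger n x y' ->
    cdist (x' j0) (y' j0) <= 4 * N%:R / k * radius n j0.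
Proof.
move=> small.
have sk0 : 0 <= 2 * s * k ^+ 2 by rewrite !mulr_ge0 ?exprn_ge0 ?ltW.
have sk : 2 * s * k <= 1.
  have h : 2 * s * k ^+ 2 < 1.
    apply: le_lt_trans small; rewrite ler_peMl // ler1n; exact: fact_gt0.
  have : 2 * s * k <= 2 * s * k ^+ 2.
    by rewrite expr2 mulrA ler_peMr ?ltW// !mulr_gt0.
  lra.
pose V (q : R[i]) (p : 'I_N -> R[i]) := exists (Q : C R) (P : 'I_N -> C R) z,
  [/\ q = toc Q, forall j, p j = toc (P j),
     forall j, cdist (z j) (x j) <= radius n j &
    [/\ gauss_int Q, forall j, gauss_int (P j), Q <> (0, 0),
        k ^+ n <= cnorm Q <= k ^+ n.+1 &
        forall j, i j != 0 ->
          cnorm (csub (cmul Q (z j)) (P j)) <= cnorm Q * (radius n j / k)]].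
have rk n' j : radius n' j / k <= radius n' j.
  by rewrite ler_pdivrMr // ler_peMr ?(ltW k1)// ltW ?radius_gt0.
(* The factor 2 collects the distance from [x] to [z] and that from [z] to [p / q], each at most
   [radius n j]; clearing the denominator costs [|q| <= k^(n+1)]. *)
have [| |||b [a [aI aV abV]]] := @resonant_hyperplane R N (fun j => i j != 0)
  (fun j => toc (x j)) (fun j => k ^+ n.+1 * (2 * radius n j)) (k ^+ n.+1) V.
- by rewrite exprn_ege1 // ltW.
- move=> j; have kn : 0 < k ^+ n.+1 by rewrite exprn_gt0.
  have := radius_gt0 n j => rn; nra.
- move=> q p [Q [P [z [-> pP zx [gQ gP Q0 /andP[_ QH] hz]]]]]; split.
  + exact: gauss_int_toc.
  + by move=> j; rewrite pP; exact: gauss_int_toc.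
  + by apply/eqP => h; apply: Q0; apply: toc_inj.
  + exact: QH.
  + move=> j ij; rewrite pP.
    rewrite (_ : _ - _ = (toc (P j) - toc Q * toc (z j)) + toc Q * (toc (z j) - toc (x j))); last first.
      by rewrite mulrBr addrA subrK.
    apply: le_trans (le_normcD _ _) _.
    apply: (@le_trans _ _ (cnorm Q * (radius n j / k) + cnorm Q * radius n j)).
      apply: lerD; first by rewrite normcB; exact: hz.
      by rewrite normcM; apply: ler_wpM2l; [exact: normc_ge0|exact: zx].
    rewrite -mulrDr; apply: ler_pM => //; first exact: sqrtr_ge0.
      have rn := radius_gt0 n j.
      by rewrite addr_ge0 ?divr_ge0 ?(ltW rn) ?(ltW k0).
    by rewrite mulr2n mulrDl mul1r lerD.
- by apply: le_lt_trans small; rewrite ler_wpM2l // prod_radius_le.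
have [j1 _] := exists_weight.
(* Without any such rational no child is dangerous, and any coordinate serves. *)
have [V0|nV] := EM (exists q p, V q p); last first.
  exists j1 => x' y' _ [z [_ zx [q [p hq]]]]; exfalso; apply: nV.
  by exists (toc q), (fun j => toc (p j)), q, p, z.
have [j2 aj2] := aV V0.
pose w j := normc (a j) * radius n j.
(* [j0] is the coordinate in which the linear form varies most over the rectangle. *)
case: (Order.TotalTheory.arg_maxP (P := predT) w (erefl : predT j2)) => j0 _ maxw.
have aj0 : 0 < normc (a j0).
  have : 0 < w j2.
    rewrite mulr_gt0 ?radius_gt0// lt_neqAle normc_ge0 andbT eq_sym.
    by apply: contra aj2 => /eqP /eq0_normc ->.
  move=> /lt_le_trans /(_ (maxw j2 isT)); rewrite pmulr_lgt0 //; exact: radius_gt0.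
have bnd x' : meets_danger n x x' ->
    normc (b + \sum_j a j * toc (x' j)) <= 2 * N%:R / k * w j0.
  move=> [z [zx' zx [q [p [gq gp q0 qH hz]]]]].
  have nq : toc q != 0 by apply/eqP => h; apply: q0; apply: toc_inj.
  have Vqp : V (toc q) (fun j => toc (p j)) by exists q, p, z.
  have -> : b = - \sum_j a j * (toc (p j) / toc q).
    apply: (mulIf nq); have /eqP := abV _ _ Vqp; rewrite addr_eq0 => /eqP ->.
    rewrite mulNr mulr_suml; congr (- _); apply: eq_bigr => j _.
    by rewrite -mulrA divfK.
  rewrite addrC -sumrB; apply: le_trans (normc_sum _ _ _) _.
  have -> : 2 * N%:R / k * w j0 = \sum_(j < N) 2 / k * w j0.
    by rewrite sumr_const card_ord -mulr_natr; ring.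
  apply: ler_sum => j _; rewrite -mulrBr normcM.
  (* Danger says nothing about coordinates of weight 0, but there the coefficient vanishes. *)
  have [/eqP ij|ij] := boolP (i j == 0).
    rewrite aI ?ij ?eqxx// normc0 mul0r mulr_ge0 ?divr_ge0 ?(ltW k0)//.
    by rewrite mulr_ge0 ?normc_ge0// ltW // radius_gt0.
  apply: (@le_trans _ _ (2 / k * w j)); last first.
    by rewrite ler_wpM2l ?divr_ge0 ?(ltW k0)//; exact: maxw.
  rewrite /w mulrCA ler_wpM2l ?normc_ge0//.
  rewrite (_ : _ - _ = (toc (x' j) - toc (z j)) + (toc (z j) - toc (p j) / toc q)); last first.
    by rewrite addrA subrK.
  apply: le_trans (le_normcD _ _) _.
  rewrite (_ : 2 / k * _ = radius n j / k + radius n j / k); last by ring.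
  apply: lerD.
    by rewrite normcB; apply: le_trans (radiusS_le n j); exact: zx'.
  have := hz _ ij; rewrite cnorm_cmulB // ler_pM2l //.
  by rewrite (lt_le_trans ltr01)// gauss_int_norm_ge1.
exists j0 => x' y' xy /bnd hx /bnd hy.
have e : a j0 * (toc (x' j0) - toc (y' j0)) =
    (b + \sum_j a j * toc (x' j)) - (b + \sum_j a j * toc (y' j)).
  rewrite opprD addrACA subrr add0r -sumrB (bigD1 j0) //= big1 ?addr0 ?mulrBr//.
  by move=> j /xy ->; rewrite subrr.
rewrite -(ler_pM2l aj0) cdistE -normcM e.
rewrite (_ : _ * (4 * _ / _ * _) = 2 * N%:R / k * w j0 + 2 * N%:R / k * w j0); last first.
  by rewrite /w; ring.
apply: le_trans (le_normcD _ _) _; apply: lerD => //.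
by rewrite -(normcN (b + _ : Rcomplex R)) in hy.
Qed.

End Scales.

Import Normc.

(** * Topology and measurability of discs *)

Section PlaneTopology.
Variable R : realType.
Implicit Types c z w : C R.

(** Without the square root a disc is a sublevel set of a polynomial, from which measurability and
    closedness follow. *)
Lemma cball_sqr c r : 0 <= r ->
  cball c r = [set z | (z.1 - c.1) ^+ 2 + (z.2 - c.2) ^+ 2 <= r ^+ 2].
Proof.
move=> r0; apply/seteqP; split=> z; rewrite /cball /cdist /cnorm /csub /= => h.
  rewrite -[leLHS]sqr_sqrtr ?addr_ge0 ?sqr_ge0//.
  by rewrite ler_sqr ?nnegrE ?sqrtr_ge0.
by rewrite -(ger0_norm r0) -sqrtr_sqr ler_sqrt ?sqr_ge0.
Qed.

Lemma cball_neg c r : r < 0 -> cball c r = set0.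
Proof.
move=> r0; apply/seteqP; split=> // z; rewrite /cball /= => h.
by have := le_lt_trans (le_trans (cdist_ge0 z c) h) r0; rewrite ltxx.
Qed.

Lemma measurable_cball c r : measurable (cball c r).
Proof.
have [r0|/cball_neg ->] := leP 0 r; last exact: measurable0.
rewrite cball_sqr // -[X in measurable X]setTI.
by apply: measurable_fun_le => //; apply: measurable_funD; apply: measurable_funX;
  apply: measurable_funB.
Qed.

Lemma closed_cball c r : closed (cball c r).
Proof.
have [r0|/cball_neg ->] := leP 0 r; last exact: closed0.
rewrite cball_sqr //.
apply: (@closed_comp _ _ (fun z : C R => (z.1 - c.1) ^+ 2 + (z.2 - c.2) ^+ 2) [set t | t <= r ^+ 2]).
  move=> z _; apply: cvgD; apply: cvgM; apply: cvgB; try exact: cvg_cst; try exact: cvg_fst; exact: cvg_snd.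
exact: closed_le.
Qed.

Lemma cdist_ball c e z : cdist z c < e -> ball c e z.
Proof.
move=> h; have e0 : 0 < e by exact: le_lt_trans (cdist_ge0 _ _) h.
have h2 : (z.1 - c.1) ^+ 2 + (z.2 - c.2) ^+ 2 < e ^+ 2.
  move: h; rewrite /cdist /cnorm /csub /= -(ltr_sqr) ?nnegrE ?sqrtr_ge0 ?(ltW e0)//.
  by rewrite sqr_sqrtr ?addr_ge0 ?sqr_ge0.
have aux (t : R) : t ^+ 2 < e ^+ 2 -> `|t| < e.
  by move=> ht; rewrite -ltr_sqr ?nnegrE ?(ltW e0)// real_normK ?num_real.
split; rewrite /ball /= distrC; apply: aux; apply: le_lt_trans h2.
  by rewrite lerDl sqr_ge0.
by rewrite lerDr sqr_ge0.
Qed.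

Lemma compact_closed_plane (A : set (C R)) : compact A -> closed A.
Proof. by apply: compact_closed; exact: norm_hausdorff. Qed.

End PlaneTopology.

(** * Measures of finite unions *)

Section FiniteUnions.
Variables (R : realType) (d : measure_display) (T : measurableType d).
Variables (mu : {measure set T -> \bar R}) (X : choiceType) (G : X -> set T).
Hypothesis mG : forall x, measurable (G x).

Lemma measurable_bigU_seq (S : seq X) : measurable (\big[setU/set0]_(x <- S) G x).
Proof. by apply: bigsetU_measurable. Qed.

Lemma in_bigU_seq (S : seq X) z :
  (\big[setU/set0]_(x <- S) G x) z <-> exists2 x, x \in S & G x z.
Proof.
rewrite -bigcup_seq; split=> [[x /= xS Gx]|[x xS Gx]]; exists x => //.
Qed.

Lemma measure_disjoint_seq (S : seq X) : uniq S ->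
  (forall x y, x \in S -> y \in S -> x != y -> G x `&` G y = set0) ->
  mu (\big[setU/set0]_(x <- S) G x) = (\sum_(x <- S) mu (G x))%E.
Proof.
elim: S => [_ _|x S ih /= /andP[xS uS] disj]; first by rewrite !big_nil measure0.
rewrite !big_cons measureU //; last 2 first.
- exact: measurable_bigU_seq.
- apply/seteqP; split=> // z [Gx /in_bigU_seq[y yS Gy]].
  rewrite -(disj x y) ?inE ?eqxx ?yS ?orbT//.
  by apply: contraNneq xS => ->.
by congr (_ + _)%E; apply: ih => // y y' yS y'S; apply: disj; rewrite inE ?yS ?y'S orbT.
Qed.

Lemma measure_le_seq (S : seq X) :
  (mu (\big[setU/set0]_(x <- S) G x) <= \sum_(x <- S) mu (G x))%E.
Proof.
elim: S => [|x S ih]; first by rewrite !big_nil measure0.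
rewrite !big_cons; apply: le_trans (measureU2 _ _ _) _ => //.
  exact: measurable_bigU_seq.
by rewrite leeD2l.
Qed.

End FiniteUnions.

Lemma sum_const_seq (R : pzSemiRingType) (X : Type) (S : seq X) (e : R) :
  \sum_(x <- S) e = (size S)%:R * e.
Proof. by rewrite big_const_seq count_predT iter_addr_0 mulr_natl. Qed.

(** The inequality is strict so that closed discs of radius [t / 2] about the points are
    disjoint. *)
Definition separated (R : realType) (t : R) (S : seq (C R)) :=
  forall x y, x \in S -> y \in S -> x != y -> t < cdist x y.

(** * Packing and covering under condition (A) *)

Section Packing.
Variables (R : realType) (Om : set (C R)) (mu : {measure set (C R) -> \bar R}).
Variables (delta r0 a b : R).
Hypotheses (mu_fin : (mu setT < +oo)%E) (mu_Om : mu (~` Om) = 0%E).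
Hypothesis cOm : compact Om.
Hypotheses (r0_gt0 : 0 < r0) (a_gt0 : 0 < a) (b_gt0 : 0 < b).
Hypothesis condA_lb : forall c r, Om c -> 0 < r -> r <= r0 ->
  ((a * r `^ delta)%:E <= mu (cball c r))%E.
Hypothesis condA_ub : forall c r, Om c -> 0 < r -> r <= r0 ->
  (mu (cball c r) <= (b * r `^ delta)%:E)%E.

Implicit Types (S : seq (C R)) (x y c : C R) (r : R).

(** Real-valued because the measure is finite; products of these values over the coordinates act as
    masses of rectangles. *)
Definition mass (A : set (C R)) : R := fine (mu A).

Lemma massE A : measurable A -> mu A = (mass A)%:E.
Proof.
move=> mA; rewrite fineK // ge0_fin_numE ?measure_ge0//.
by apply: le_lt_trans mu_fin; apply: le_measure; rewrite ?inE.
Qed.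

Lemma mass_ge0 A : 0 <= mass A.
Proof. by rewrite fine_ge0 ?measure_ge0. Qed.

Lemma mass_le A B : measurable A -> measurable B -> A `<=` B -> mass A <= mass B.
Proof.
by move=> mA mB AB; rewrite -lee_fin -!massE //; apply: le_measure; rewrite ?inE.
Qed.

Lemma mass_lb c r : Om c -> 0 < r -> r <= r0 -> a * r `^ delta <= mass (cball c r).
Proof.
move=> *; rewrite -lee_fin -massE; last exact: measurable_cball.
exact: condA_lb.
Qed.

Lemma mass_ub c r : Om c -> 0 < r -> r <= r0 -> mass (cball c r) <= b * r `^ delta.
Proof.
move=> *; rewrite -lee_fin -massE; last exact: measurable_cball.
exact: condA_ub.
Qed.

Lemma separated_cball0 r S x y : separated (2 * r) S -> x \in S -> y \in S ->
  x != y -> cball x r `&` cball y r = set0.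
Proof.
move=> sS xS yS xy; apply/seteqP; split=> // z [zx zy].
have := sS _ _ xS yS xy; have := cdist_triangle z x y.
by move: zx zy; rewrite /cball /= (cdistC x z); lra.
Qed.

(** The discs are disjoint. [B] will be a covering set, whose mass in the parent is shared out among
    the children. *)
Lemma sum_mass_le S r (A B : set (C R)) : uniq S -> separated (2 * r) S ->
  measurable A -> measurable B ->
  (forall x, x \in S -> cball x r `<=` A) ->
  \sum_(x <- S) mass (cball x r `&` B) <= mass (A `&` B).
Proof.
move=> uS sS mA mB sub.
have mG x : measurable (cball x r `&` B).
  by apply: measurableI => //; exact: measurable_cball.
rewrite -lee_fin -massE; last exact: measurableI.
rewrite -sumEFin; under eq_bigr do rewrite -massE //.
rewrite -(measure_disjoint_seq _ mG uS); last first.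
  by move=> x y xS yS xy; rewrite setIACA (separated_cball0 sS) // set0I.
apply: le_measure; rewrite ?inE.
- exact: measurable_bigU_seq.
- exact: measurableI.
- by move=> z /in_bigU_seq[x xS [zx Bz]]; split => //; exact: sub zx.
Qed.

Lemma size_separated_le S r (A : set (C R)) : uniq S -> separated (2 * r) S ->
  0 < r -> r <= r0 -> measurable A ->
  (forall x, x \in S -> Om x /\ cball x r `<=` A) ->
  (size S)%:R * (a * r `^ delta) <= mass A.
Proof.
move=> uS sS rp rr mA sub.
rewrite -[A]setIT; apply: le_trans (sum_mass_le uS sS mA measurableT _); last first.
  by move=> x /sub[].
rewrite -sum_const_seq big_seq [leRHS]big_seq.
by apply: ler_sum => x /sub[Ox _]; rewrite setIT; exact: mass_lb.
Qed.

(** The disjoint discs of radius [r] each have mass at least [a * r^delta], so finiteness of [mu]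
    bounds the size of separated sets; a largest one cannot be enlarged and is therefore a net. *)
Lemma maximal_separated (A : set (C R)) r : A `<=` Om -> 0 < r -> r <= r0 ->
  exists S, [/\ uniq S, forall x, x \in S -> A x, separated (2 * r) S &
    forall y, A y -> exists2 x, x \in S & cdist y x <= 2 * r].
Proof.
move=> AO rp rr.
pose P n := `[< exists S, [/\ uniq S, forall x, x \in S -> A x, separated (2 * r) S & size S = n] >].
have exP : exists n, P n by exists 0; apply/asboolP; exists [::].
have ubP n : P n -> (n <= Num.truncn (mass setT / (a * r `^ delta)))%N.
  move=> /asboolP[S [uS SA sS <-]]; have q0 : 0 < a * r `^ delta by rewrite mulr_gt0 ?powR_gt0.
  rewrite -ltnS -(ltr_nat R); apply: le_lt_trans (truncnS_gt _).
  rewrite ler_pdivlMr //; apply: size_separated_le => //.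
  by move=> x /SA /AO.
case: (ex_maxnP exP ubP) => n /asboolP[S [uS SA sS sn]] maxn.
exists S; split => // y Ay; apply: contrapT => nx.
have nS : y \notin S by apply/negP => yS; apply: nx; exists y; rewrite // cdistxx mulr_ge0 ?ltW.
have far x : x \in S -> 2 * r < cdist y x.
  by move=> xS; rewrite ltNge; apply/negP => h; apply: nx; exists x.
suff : P n.+1 by move/maxn; rewrite ltnn.
apply/asboolP; exists (y :: S); split=> /=; rewrite ?nS ?sn//.
  by move=> x; rewrite inE => /orP[/eqP->//|]; exact: SA.
move=> x x'; rewrite !inE => /orP[/eqP->|xS] /orP[/eqP->|xS'] //; rewrite ?eqxx//.
- by move=> _; exact: far.
- by move=> _; rewrite cdistC; exact: far.
- exact: sS.
Qed.

(** [Om] is a countable intersection of finite unions of discs about finer and finer nets: a point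
    of all these unions is a limit of points of [Om], which is closed. Hence its complement is a
    measurable null set. *)
Lemma measurable_support : measurable Om.
Proof.
pose t n := r0 / n.+1%:R.
have t0 n : 0 < t n by rewrite divr_gt0 // ltr0n.
have tr n : t n <= r0 by rewrite ler_pdivrMr ?ltr0n// ler_peMr ?(ltW r0_gt0)// ler1n.
pose Q n (S : seq (C R)) := (forall x, x \in S -> Om x) /\
  (forall y, Om y -> exists2 x, x \in S & cdist y x <= 2 * t n).
have [S hS] : {S : nat -> seq (C R) & forall n, Q n (S n)}.
  apply: choice => n.
  by have [S [_ h1 _ h2]] := maximal_separated (@subset_refl _ Om) (t0 n) (tr n); exists S.
rewrite (_ : Om = \bigcap_n \big[setU/set0]_(x <- S n) cball x (2 * t n)).
  apply: bigcapT_measurable => n; apply: measurable_bigU_seq => x.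
  exact: measurable_cball.
apply/seteqP; split=> z.
  move=> Oz n _; have [_ /(_ _ Oz)[x xS h]] := hS n.
  by apply/in_bigU_seq; exists x.
move=> hz; apply: (compact_closed_plane cOm) => B /nbhs_ballP[e /= e0 eB].
pose n := Num.truncn (2 * r0 / e).
have ne : 2 * t n < e.
  have := truncnS_gt (2 * r0 / e); rewrite -/n ltr_pdivrMr // => h.
  by rewrite /t mulrA ltr_pdivrMr ?ltr0n// [e * _]mulrC.
have /in_bigU_seq[x xS zx] := hz n I.
exists x; split; first by have [h _] := hS n; exact: h.
by apply: eB; apply: cdist_ball; rewrite cdistC; apply: le_lt_trans ne.
Qed.

(** Discs of radius [2 * r] about a maximal separated set cover the part of [Om] in the disc of
    radius [t / 2]; comparing masses bounds their number below. Halving [t] leaves room for the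
    children inside the parent. *)
Lemma exists_children c t r : Om c -> 0 < t -> t <= r0 -> 0 < r -> 2 * r <= r0 ->
  exists S, [/\ uniq S, forall x, x \in S -> Om x /\ cdist x c <= t / 2,
    separated (2 * r) S &
    a * (t / 2) `^ delta <= (size S)%:R * (b * (2 * r) `^ delta)].
Proof.
move=> Oc tp tr rp rr.
have r1 : r <= r0 by lra.
have [S [uS SA sS cov]] := maximal_separated (@subIsetl _ Om (cball c (t / 2))) rp r1.
exists S; split => //.
apply: (@le_trans _ _ (mass (cball c (t / 2)))); first by apply: mass_lb => //; lra.
have mc x s : measurable (cball x s) by exact: measurable_cball.
have mU := measurable_bigU_seq (fun x => mc x (2 * r)) S.
have mO : measurable (~` Om) by apply: measurableC; exact: measurable_support.
rewrite -sum_const_seq -lee_fin -massE // -sumEFin.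
apply: (@le_trans _ _ (mu ((\big[setU/set0]_(x <- S) cball x (2 * r)) `|` ~` Om))).
  apply: le_measure; rewrite ?inE //; first exact: measurableU.
  move=> z zc; have [Oz|] := EM (Om z); last by right.
  by left; apply/in_bigU_seq; have [//|x xS h] := cov z; exists x.
rewrite measureU0 //; apply: le_trans (measure_le_seq _ _ _) _ => //.
rewrite big_seq [leRHS]big_seq; apply: lee_sum => x /SA[Ox _].
by apply: condA_ub => //; lra.
Qed.

(** The disjoint discs of radius [r <= t] all lie in one disc of radius [2 * t]. *)
Lemma size_crowd_le S r t : uniq S -> (forall x, x \in S -> Om x) ->
  separated (2 * r) S -> 0 < r -> r <= t -> 2 * t <= r0 ->
  (forall x y, x \in S -> y \in S -> cdist x y <= t) ->
  (size S)%:R * (a * r `^ delta) <= b * (2 * t) `^ delta.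
Proof.
case: S => [*|x0 S0]; first by rewrite mul0r mulr_ge0 ?powR_ge0 ?(ltW b_gt0).
set S := x0 :: S0 => uS SO sS rp rt tr close.
have x0S : x0 \in S by rewrite inE eqxx.
apply: (@le_trans _ _ (mass (cball x0 (2 * t)))); last first.
  by apply: mass_ub => //; [exact: SO|lra].
apply: size_separated_le => //; [by lra|exact: measurable_cball|].
move=> x xS; split; first exact: SO.
move=> z; rewrite /cball /= => zx.
have := cdist_triangle x z x0; have := close _ _ xS x0S; lra.
Qed.

(** If [delta <= 0], then [r^delta >= 1] for [r <= 1], so discs shrinking to a point of [Om] keep
    mass at least [a] and the point is an atom. *)
Lemma exponent_gt0 : Om !=set0 -> (forall x, mu [set x] = 0%E) -> 0 < delta.
Proof.
move=> [c Oc] mu0; rewrite ltNge; apply/negP => d0.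
pose t1 := Num.min r0 1.
have t1p : 0 < t1 by rewrite lt_min r0_gt0 ltr01.
pose t n := t1 / n.+1%:R.
have t0 n : 0 < t n by rewrite divr_gt0 // ltr0n.
have tt1 n : t n <= t1 by rewrite ler_pdivrMr ?ltr0n// ler_peMr ?(ltW t1p)// ler1n.
have tr n : t n <= r0 by apply: le_trans (tt1 n) _; rewrite ge_min lexx.
have t1' n : t n <= 1 by apply: le_trans (tt1 n) _; rewrite ge_min lexx orbT.
have cap : \bigcap_n cball c (t n) = [set c].
  apply/seteqP; split=> z /=; last by move=> -> n _; rewrite /cball /= cdistxx ltW.
  move=> h; apply: toc_inj; apply/eqP; rewrite -subr_eq0; apply/eqP; apply: eq0_normc.
  apply/eqP; rewrite eq_le normc_ge0 andbT leNgt; apply/negP => e0.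
  have := truncnS_gt (t1 / normc (toc z - toc c)).
  set n := Num.truncn _; rewrite ltr_pdivrMr // mulrC -ltr_pdivrMr ?ltr0n// => h2.
  by have := lt_le_trans h2 (h n I); rewrite ltxx.
have lim : (mu \o (fun n => cball c (t n))) n @[n --> \oo] --> mu [set c].
  rewrite -cap; apply: nonincreasing_cvg_mu.
  - by rewrite massE ?ltry//; exact: measurable_cball.
  - by move=> n; exact: measurable_cball.
  - by rewrite cap (_ : [set c] = \bigcap_n cball c (t n)) //; apply: bigcapT_measurable => n; exact: measurable_cball.
  - move=> m n mn; apply/subsetPset => z; rewrite /cball /= => h; apply: le_trans h _.
    by rewrite ler_pM2l // lef_pV2 ?posrE ?ltr0n// ler_nat.
have : (a%:E <= mu [set c])%E.
  rewrite -(cvg_lim _ lim) //; apply: lime_ge; first by apply/cvg_ex; eexists; exact: lim.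
  apply: nearW => n /=; apply: le_trans (condA_lb Oc (t0 n) (tr n)).
  rewrite lee_fin ler_peMr ?(ltW a_gt0)// -(powRr0 (t n)).
  by apply: ger_powR => //; rewrite t0 t1'.
by rewrite mu0 lee_fin leNgt a_gt0.
Qed.

End Packing.

Import Normc.

(** * Finite products of sets of children, and averaging *)

Section ProductPoints.
Variables (X : choiceType) (x0 : X) (N M : nat) (S : 'I_N -> seq X).
Hypothesis SM : forall j, (size (S j) <= M)%N.

(** Lists of different lengths are indexed by one type ['I_M], so that their product becomes a
    family of finite functions. *)
Definition index_in (j : 'I_N) : pred 'I_M := fun l => (l < size (S j))%N.
Definition point (f : {ffun 'I_N -> 'I_M}) (j : 'I_N) : X := nth x0 (S j) (f j).

Definition subst_at (j0 : 'I_N) (f : {ffun 'I_N -> 'I_M}) (l : 'I_M) :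
  {ffun 'I_N -> 'I_M} := [ffun j => if j == j0 then l else f j].

Lemma point_in f j : f \in family index_in -> point f j \in S j.
Proof. by move=> /familyP/(_ j) h; apply: mem_nth. Qed.

Lemma sum_nth (V : nmodType) j (F : X -> V) :
  \sum_(l < M | index_in j l) F (nth x0 (S j) l) = \sum_(x <- S j) F x.
Proof. by rewrite (big_nth x0) big_mkord (big_ord_widen M (fun l => F (nth x0 (S j) l)) (SM j)). Qed.

Lemma prod_sum_points (R : comPzSemiRingType) (F : 'I_N -> X -> R) :
  \prod_j \sum_(x <- S j) F j x =
  \sum_(f in family index_in) \prod_j F j (point f j).
Proof.
under eq_bigr do rewrite -sum_nth.
exact: bigA_distr_big_dep.
Qed.

Lemma card_points (R : comPzSemiRingType) :
  #|family index_in|%:R = \prod_j (size (S j))%:R :> R.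
Proof.
rewrite -sum1_card natr_sum.
rewrite (_ : \prod_j _ = \prod_j \sum_(y <- S j) 1); last first.
  by apply: eq_bigr => j _; rewrite sum_const_seq mulr1.
rewrite (prod_sum_points (fun _ _ => 1)).
by apply: eq_bigr => f _; rewrite big1_eq.
Qed.

(* Swapping [f j0] with [l] is an involution of the pairs [(f, l)]; counting the pairs with [f] bad
   in both ways transfers the bound on the fibres over [j0] to the whole product. *)
Lemma half_good j0 (bad : pred {ffun 'I_N -> 'I_M}) :
  (forall f, f \in family index_in ->
    (2 * #|[pred l | index_in j0 l && bad (subst_at j0 f l)]| <= size (S j0))%N) ->
  (#|family index_in| <= 2 * #|[pred f | (f \in family index_in) && ~~ bad f]|)%N.
Proof.
move=> half; set fam := family index_in; set m := size (S j0).
have cardQ : #|index_in j0| = m.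
  by rewrite -sum1_card (sum_nth j0 (fun=> 1%N)) sum1_size.
have [m0|m0] := posnP m.
  rewrite (_ : #|fam| = 0%N) //; apply: eq_card0 => f; apply/negP => /familyP/(_ j0).
  by rewrite unfold_in /index_in -/m m0.
pose phi (p : {ffun 'I_N -> 'I_M} * 'I_M) := (subst_at j0 p.1 p.2, p.1 j0).
have phiK : involutive phi.
  move=> [f l]; rewrite /phi /=; congr (_, _); last by rewrite ffunE eqxx.
  by apply/ffunP => j; rewrite !ffunE; case: eqP => [->|].
have famphi f l : (subst_at j0 f l \in fam) && index_in j0 (f j0) = (f \in fam) && index_in j0 l.
  apply/andP/andP => [[/familyP h1 h2]|[/familyP h1 h2]]; split.
  - apply/familyP => j; have := h1 j; rewrite ffunE; case: eqP => [->|//] _; exact: h2.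
  - by have := h1 j0; rewrite ffunE eqxx.
  - by apply/familyP => j; rewrite ffunE; case: eqP => [->|_]; [exact: h2|exact: h1].
  - exact: h1.
have key : (2 * \sum_(f in fam) \sum_(l | index_in j0 l) bad f <= #|fam| * m)%N.
  rewrite pair_big_dep /= (reindex_inj (inv_inj phiK)) /=.
  under eq_bigl do rewrite famphi.
  rewrite (_ : \sum_(p | _) _ =
    \sum_(f in fam) \sum_(l | index_in j0 l) bad (subst_at j0 f l))%N; last first.
    by rewrite pair_big_dep.
  rewrite big_distrr /=.
  rewrite -sum_nat_const; apply: leq_sum => f fF.
  apply: leq_trans (half f fF); rewrite leq_mul2l /= -sum1_card big_mkcond [leqRHS]big_mkcond /=.
  by apply: leq_sum => l _; rewrite inE; case: (index_in j0 l); case: (bad _).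
have : (2 * #|[pred f | (f \in fam) && bad f]| * m <= #|fam| * m)%N.
  apply: leq_trans key; rewrite -mulnA leq_mul2l /= -sum1_card big_distrl /=.
  rewrite big_mkcond [leqRHS]big_mkcond /=; apply: leq_sum => f _.
  by rewrite inE; case: (f \in fam) => //=; case: (bad f) => //=; rewrite sum_nat_const cardQ muln1 mul1n.
have -> : #|fam| = (#|[pred f | (f \in fam) && bad f]| + #|[pred f | (f \in fam) && ~~ bad f]|)%N.
  rewrite -[LHS](cardID bad); congr (_ + _)%N; apply: eq_card => f; rewrite !inE //.
  by rewrite andbC.
by rewrite leq_pmul2r //; lia.
Qed.

End ProductPoints.

(** If every [f] in [G] failed, summing over [G] and exchanging the finite with the infinite sum of
    nonnegative terms would give [#|G| * theta] at most [#|G|] times the sum of [w]. *)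
Lemma averaging (R : realType) (I : finType) (G : pred I) (w : nat -> R)
    (w' : I -> nat -> R) (theta : R) :
  (0 < #|G|)%N -> (forall n, 0 <= w n) -> (forall f n, 0 <= w' f n) ->
  (forall n, \sum_(f | G f) w' f n <= #|G|%:R * w n) ->
  (\sum_(n <oo) (w n)%:E < theta%:E)%E ->
  exists2 f, G f & (\sum_(n <oo) (w' f n)%:E < theta%:E)%E.
Proof.
move=> G0 w0 w'0 le_w lt_w; apply: contrapT => nex.
have ge_th f : G f -> (theta%:E <= \sum_(n <oo) (w' f n)%:E)%E.
  by move=> Gf; rewrite leNgt; apply/negP => h; apply: nex; exists f.
have G0R : (0 < #|G|%:R%:E :> \bar R)%E by rewrite lte_fin ltr0n.
have h1 : (#|G|%:R%:E * theta%:E <= \sum_(f | G f) \sum_(n <oo) (w' f n)%:E)%E.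
  apply: (@le_trans _ _ (\sum_(f | G f) theta%:E)%E); last exact: lee_sum.
  by rewrite sumEFin -EFinM lee_fin sumr_const mulr_natl.
have h2 : (\sum_(f | G f) \sum_(n <oo) (w' f n)%:E <= #|G|%:R%:E * \sum_(n <oo) (w n)%:E)%E.
  rewrite -nneseries_sum; last by move=> *; rewrite lee_fin.
  rewrite -nneseriesZl; last by move=> *; rewrite lee_fin.
  apply: lee_nneseries => [n _ _|n _]; first by apply: sume_ge0 => *; rewrite lee_fin.
  by rewrite sumEFin -EFinM lee_fin.
have := le_trans h1 h2; rewrite lee_pmul2l //.
by rewrite leNgt lt_w.
Qed.

(** * Matching a diameter with a level *)

Section Levels.
Variable R : realType.
Implicit Types k u : R.

Lemma exists_pow_gt k u : 2 <= k -> exists n, u < k ^+ n.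
Proof.
move=> k2; exists (Num.Def.archi_bound u).
apply: lt_le_trans (upper_nthrootP (leqnn _)) _.
by rewrite lerXn2r ?nnegrE ?(le_trans _ k2).
Qed.

Lemma exists_level k u : 2 <= k -> 1 <= u -> exists n, k ^+ n <= u < k ^+ n.+1.
Proof.
move=> k2 u1; have exP := exists_pow_gt u k2.
case: (ex_minnP exP) => -[|n] h minn; first by move: h; rewrite expr0 ltNge u1.
exists n; rewrite h andbT leNgt; apply/negP => /minn; by rewrite ltnn.
Qed.

(* A covering set of diameter [d] is treated at the level [n] whose scale [s k^-n] is just above [d];
   the slack [e] serves the sets of diameter [0], to which no level would be attached. *)
Lemma exists_cover_level k s t lam d e : 2 <= k -> 0 < s -> 0 <= t ->
  0 <= lam -> lam <= k `^ (- t) / 2 -> 0 <= d -> d <= s -> 0 < e ->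
  exists n, d <= s / k ^+ n /\ lam ^+ n <= k `^ t * s `^ (- t) * d `^ t + e.
Proof.
move=> k2 s0 t0 lam0 lam_le d0 ds e0.
have k0 : 0 < k by lra.
have kt1 : k `^ (- t) <= 1.
  by rewrite -(powRr0 k); apply: ler_powR; [lra|rewrite oppr_le0].
have kt0 : 0 < k `^ (- t) by rewrite powR_gt0.
have [d_eq0|dneq0] := eqVneq d 0.
  have [n hn] := @exists_pow_gt 2 e^-1 (lexx _).
  exists n; rewrite d_eq0 divr_ge0 ?exprn_ge0 ?(ltW s0) ?(ltW k0)//; split=> //.
  apply: ler_wpDl; first by rewrite !mulr_ge0 ?powR_ge0.
  apply: (@le_trans _ _ (2^-1 ^+ n)).
    by apply: lerXn2r; rewrite ?nnegrE ?invr_ge0//; lra.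
  by rewrite exprVn -[leRHS]invrK lef_pV2 ?posrE ?invr_gt0 ?exprn_gt0// ltW.
have dp : 0 < d by rewrite lt_neqAle eq_sym dneq0.
have sd : 1 <= s / d by rewrite ler_pdivlMr // mul1r.
have [n /andP[n1 n2]] := exists_level k2 sd.
have kn n' : 0 < k ^+ n' by rewrite exprn_gt0.
exists n; split; first by rewrite ler_pdivlMr // mulrC -ler_pdivlMr.
apply: ler_wpDr; first exact: ltW.
apply: (@le_trans _ _ ((k `^ (- t)) ^+ n)).
  by apply: lerXn2r; rewrite ?nnegrE ?(ltW kt0)//; lra.
(* The factor [k^t] pays for passing from [k^n] to [k^(n+1)], the power that exceeds [s / d]. *)
have -> : k `^ (- t) ^+ n = k `^ t * (k ^+ n.+1) `^ (- t).
  rewrite exprS powRM ?(ltW k0) ?(ltW (kn _))// mulrA -powR_addr // subrr powRr0 mul1r.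
  by rewrite -(powR_mulrn n (powR_ge0 k (- t))) -(powR_mulrn n (ltW k0)) powRAC.
rewrite -mulrA ler_pM2l ?powR_gt0//.
have -> : s `^ (- t) * d `^ t = (s / d) `^ (- t).
  rewrite powRM ?invr_ge0 ?(ltW s0) ?d0//; congr (_ * _).
  by rewrite -powR_inv1 // -powRrM mulrN mulN1r opprK.
rewrite !powRN lef_pV2 ?posrE ?powR_gt0 ?divr_gt0//.
by apply: ge0_ler_powR => //; rewrite ?nnegrE ?divr_ge0 ?(ltW s0) ?(ltW (kn _))// ltW.
Qed.

End Levels.

Lemma cdist_le_distCN (R : realType) N (z w : 'I_N -> C R) j :
  cdist (z j) (w j) <= distCN z w.
Proof. exact: (le_bigmax_cond 0 (P := predT) (fun j => cdist (z j) (w j))). Qed.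

Lemma distCN_le (R : realType) N (z w : 'I_N -> C R) e :
  0 <= e -> (forall j, cdist (z j) (w j) <= e) -> distCN z w <= e.
Proof. by move=> e0 h; apply: bigmax_le. Qed.

(** * Limits of nested discs *)

Section LimitPoint.
Variables (R : realType) (Om : set (C R)) (x : nat -> C R) (r : nat -> R).
Hypotheses (cOm : compact Om) (Ox : forall n, Om (x n)).
Hypothesis near_x : forall n, cdist (x n.+1) (x n) <= r n / 2.
Hypothesis half_r : forall n, r n.+1 <= r n / 2.

(** The step to the next centre is at most [r n / 2 <= r n - r n.+1], so the distances telescope and
    the discs are nested. Compactness gives a cluster point in [Om], and each closed disc contains
    it along with the tail. *)
Lemma nested_limit : exists2 z, Om z & forall n, cdist z (x n) <= r n.
Proof.
have rge0 n : 0 <= r n.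
  by have := near_x n; have := cdist_ge0 (x n.+1) (x n); lra.
have tail n d : cdist (x (d + n)%N) (x n) <= r n - r (d + n)%N.
  elim: d => [|d ih]; first by rewrite add0n cdistxx subrr.
  have := cdist_triangle (x (d + n)%N) (x (d.+1 + n)%N) (x n).
  by have := near_x (d + n); have := half_r (d + n); rewrite addSn; lra.
have FO : (x @ \oo) Om by exists 0%N => // n _; exact: Ox.
have [z [Oz clz]] := cOm (F := x @ \oo) _ FO.
exists z => // n; apply: (@closed_cball R (x n) (r n)) => B nB.
have : (x @ \oo) (cball (x n) (r n)).
  exists n => // m /= nm; rewrite /cball /= -(subnK nm).
  by have := tail n (m - n)%N; have := rge0 (m - n + n)%N; lra.
by move=> /clz /(_ nB).
Qed.

End LimitPoint.

(** * Counting children at one level *)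

Section Step.
Variables (R : realType) (N : nat) (i : 'I_N -> R) (k s : R).
Variables (Om : 'I_N -> set (C R)) (m : 'I_N -> {measure set (C R) -> \bar R}).
Variables (delta : 'I_N -> R) (r0 a b : R).
Hypotheses (k2 : 2 <= k) (kN : 8 * N%:R <= k) (s0 : 0 < s) (sr0 : s <= r0).
Hypotheses (i0 : forall j, 0 <= i j) (i1 : \sum_j i j = 1).
Hypothesis small : (N.+1)`!%:R * (2 * s * k ^+ 2) < 1.
Hypotheses (m_fin : forall j, (m j setT < +oo)%E) (m_Om : forall j, m j (~` Om j) = 0%E).
Hypothesis cOm : forall j, compact (Om j).
Hypotheses (r0_gt0 : 0 < r0) (a_gt0 : 0 < a) (b_gt0 : 0 < b).
Hypothesis condA_lb : forall j c r, Om j c -> 0 < r -> r <= r0 ->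
  ((a * r `^ delta j)%:E <= m j (cball c r))%E.
Hypothesis condA_ub : forall j c r, Om j c -> 0 < r -> r <= r0 ->
  (m j (cball c r) <= (b * r `^ delta j)%:E)%E.
Hypothesis k_large : forall j, (32 * N%:R / k) `^ delta j <= a ^+ 2 / (2 * b ^+ 2).

Let k1 : 1 < k. Proof. by apply: lt_le_trans k2; rewrite ltr1n. Qed.
Let k0 : 0 < k. Proof. exact: lt_trans k1. Qed.
Let rho := radius i k s.

Let rho0 n j : 0 < rho n j. Proof. exact: radius_gt0. Qed.

Let rhoS n j : rho n.+1 j <= rho n j / k. Proof. exact: radiusS_le. Qed.

Let rho_half n j : rho n.+1 j <= rho n j / 2.
Proof.
apply: le_trans (rhoS n j) _; rewrite ler_pM2l // lef_pV2 ?posrE //.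
Qed.

Lemma radius_le n j : rho n j <= s.
Proof.
elim: n => [|n]; first by rewrite /rho /radius expr0 mulr1.
by have := rho_half n j; have := rho0 n j; lra.
Qed.

Let rho_r0 n j : rho n j <= r0. Proof. exact: le_trans (radius_le n j) sr0. Qed.

Let N1 : 1 <= N%:R :> R.
Proof.
have [j _] := exists_weight i1.
by rewrite ler1n; case: j => j; apply: leq_trans.
Qed.

(** The mass of a rectangle of level [n] predicted by condition (A), up to constants. *)
Definition volume n := \prod_j rho n j `^ delta j.

(** Bounds the volume lost in one step: [b / a * 4^delta] comes from counting children, 2 from
    discarding the dangerous ones. It is independent of [k], so a large [k] outweighs it. *)
Definition loss := 2 * \prod_j (b / a * 4 `^ delta j).

Lemma loss_gt0 : 0 < loss.
Proof. by rewrite mulr_gt0 // prodr_gt0 // => j _; rewrite mulr_gt0 ?divr_gt0 ?powR_gt0. Qed.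

Lemma volume_gt0 n : 0 < volume n.
Proof. by rewrite prodr_gt0 // => j _; rewrite powR_gt0. Qed.

(** The crowd lies at scale [4 * N / k] times the parent, so its size relative to all children is at
    most [(b / a)^2 * (32 * N / k)^delta]; [k_large] makes this at most 1/2. *)
Lemma crowd_half n j (S S' : seq (C R)) c :
  uniq S -> (forall x, x \in S -> Om j x /\ cdist x c <= rho n j / 2) ->
  separated (2 * rho n.+1 j) S ->
  a * (rho n j / 2) `^ delta j <= (size S)%:R * (b * (2 * rho n.+1 j) `^ delta j) ->
  uniq S' -> {subset S' <= S} ->
  (forall x y, x \in S' -> y \in S' -> cdist x y <= 4 * N%:R / k * rho n j) ->
  (2 * size S' <= size S)%N.
Proof.
move=> uS SO sS lb uS' S'S close.
set r := rho n.+1 j in sS lb *; set t := rho n j in lb close *.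
have rp : 0 < r := rho0 _ _; have tp : 0 < t := rho0 _ _.
have tr : t <= r0 := rho_r0 _ _.
have rt : r <= 4 * N%:R / k * t.
  apply: le_trans (rhoS n j) _; rewrite -/t.
  rewrite (_ : _ * t = 4 * N%:R * (t / k)); last by ring.
  by rewrite ler_peMl ?divr_ge0 ?(ltW tp) ?(ltW k0)//; have := N1; lra.
have t8 : 2 * (4 * N%:R / k * t) <= t.
  rewrite (_ : _ * (_ * t) = 8 * N%:R * t / k); last by ring.
  by rewrite ler_pdivrMr // mulrC ler_pM2l.
have ub : (size S')%:R * (a * r `^ delta j) <= b * (2 * (4 * N%:R / k * t)) `^ delta j.
  apply: (@size_crowd_le _ (Om j) (m j) (delta j) r0 a b) => //.
  - exact: condA_lb.
  - exact: condA_ub.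
  - by move=> x /S'S /SO[].
  - by move=> x y /S'S xS /S'S yS; exact: sS.
  - by apply: le_trans t8 tr.
(* Both radii are expressed through [t / 4], so that the same power cancels from the two
   estimates. *)
have e1 : 2 * (4 * N%:R / k * t) = (32 * N%:R / k) * (t / 4) by field; rewrite gt_eqF.
have e2 : t / 2 = 2 * (t / 4) by field.
have nk : 0 <= 32 * N%:R / k by rewrite divr_ge0 ?mulr_ge0 ?(ltW k0).
have pos4 : 0 < t / 4 by rewrite divr_gt0.
move: lb ub; rewrite e1 e2; move: (t / 4) pos4 => u pos4.
rewrite (powRM _ _ (ltW pos4)) // (powRM _ _ (ltW rp)) // (powRM _ _ (ltW pos4)) //.
set rd := r `^ _; set td := u `^ _; set d2 := 2 `^ _ => lb ub.
have rdp : 0 < rd by rewrite powR_gt0.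
have tdp : 0 < td by rewrite powR_gt0.
have d2p : 0 < d2 by rewrite powR_gt0.
have {}lb : a * td <= (size S)%:R * (b * rd).
  have e3 : d2 * (a * td) = a * (d2 * td) by rewrite mulrCA.
  have e4 : d2 * ((size S)%:R * (b * rd)) = (size S)%:R * (b * (d2 * rd)).
    by rewrite mulrCA [d2 * (b * rd)]mulrCA.
  by rewrite -(ler_pM2l d2p) e3 e4.
have {}ub : (size S')%:R * (a * rd) * (2 * b) <= a ^+ 2 * td.
  have := k_large j; rewrite ler_pdivlMr ?mulr_gt0 ?exprn_gt0// => kl.
  apply: (@le_trans _ _ (b * ((32 * N%:R / k) `^ delta j * td) * (2 * b))).
    by rewrite ler_pM2r ?mulr_gt0.
  rewrite (_ : b * _ * _ = (32 * N%:R / k) `^ delta j * (2 * b ^+ 2) * td); last by ring.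
  by rewrite ler_pM2r.
rewrite -(ler_nat R) natrM.
have abr : 0 < a * rd * b by rewrite !mulr_gt0.
rewrite -(ler_pM2r abr).
apply: (@le_trans _ _ (a ^+ 2 * td)); first by apply: le_trans ub; rewrite le_eqVlt; apply/orP; left; apply/eqP; ring.
rewrite (_ : _ * (a * rd * b) = a * ((size S)%:R * (b * rd))); last by ring.
by rewrite expr2 -mulrA ler_pM2l.
Qed.

(** * The potential of a cover and the choice of a child *)

Section Potential.
Variables (B : nat -> 'I_N -> set (C R)) (lev : nat -> nat).
Hypothesis mB : forall l j, measurable (B l j).

(** The share of the rectangle taken by the product set [B l], times one factor [loss] for each
    level left before [lev l]. Beyond that level the set has been dealt with and counts 0. *)
Definition weight n (x : 'I_N -> C R) l : R :=
  if (n <= lev l)%N then loss ^+ (lev l - n) *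
    (\prod_j mass (m j) (cball (x j) (rho n j) `&` B l j) / volume n)
  else 0.

Lemma weight_ge0 n x l : 0 <= weight n x l.
Proof.
rewrite /weight; case: ifP => // _.
rewrite mulr_ge0 ?exprn_ge0 ?(ltW loss_gt0)// divr_ge0 ?(ltW (volume_gt0 _))//.
by apply: prodr_ge0 => j _; exact: mass_ge0.
Qed.

(** At least half of the products of one-coordinate children are safe. Their masses within [B l] add
    up to at most that of the parent, while their number offsets the change of volume up to [loss];
    so the potential does not grow on average, and some safe child keeps it below [theta]. *)
Lemma exists_good_child n x theta : (forall j, Om j (x j)) ->
  (\sum_(l <oo) (weight n x l)%:E < theta%:E)%E ->
  exists x', [/\ forall j, Om j (x' j),
    forall j, cdist (x' j) (x j) <= rho n j / 2,
    ~ meets_danger i k s n x x' &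
    (\sum_(l <oo) (weight n.+1 x' l)%:E < theta%:E)%E].
Proof.
move=> Ox lt_theta.
pose Q (j : 'I_N) (S : seq (C R)) := [/\ uniq S, forall y, y \in S -> Om j y /\ cdist y (x j) <= rho n j / 2,
    separated (2 * rho n.+1 j) S &
    a * (rho n j / 2) `^ delta j <= (size S)%:R * (b * (2 * rho n.+1 j) `^ delta j)].
have [S hS] : {S : 'I_N -> seq (C R) & forall j, Q j (S j)}.
  apply: choice => j.
  apply: (@exists_children _ (Om j) (m j) (delta j) r0 a b) => //.
  - exact: condA_lb.
  - exact: condA_ub.
  - by have := rho_half n j; have := rho_r0 n j; lra.
pose M := (\max_j size (S j))%N.
have SM j : (size (S j) <= M)%N by exact: (leq_bigmax j).
pose o : C R := (0, 0).
have [j0 conf] := danger_confined k1 s0 i0 i1 n x small.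
pose pt := @point (C R) o N M S.
pose bad (f : {ffun 'I_N -> 'I_M}) := `[< meets_danger i k s n x (pt f) >].
set fam := family (index_in (M := M) S).
have half : (#|fam| <= 2 * #|[pred f | (f \in fam) && ~~ bad f]|)%N.
  (* Along direction [j0] the dangerous children differ in that coordinate alone, so their centres
     are crowded. *)
  apply: (@half_good _ o _ _ _ SM j0) => f fF.
  set P := [pred l | _ & _].
  have [uS SO sS lb] := hS j0.
  have -> : #|P| = size [seq nth o (S j0) (nat_of_ord l) | l <- enum P].
    by rewrite size_map -cardE.
  apply: (crowd_half uS SO sS lb).
  - rewrite map_inj_in_uniq ?enum_uniq // => l l'; rewrite !mem_enum !inE => /andP[h1 _] /andP[h2 _] /eqP.
    by rewrite nth_uniq // => /eqP/val_inj.
  - by move=> y /mapP[l]; rewrite mem_enum inE => /andP[h _] ->; apply: mem_nth.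
  - move=> y y' /mapP[l]; rewrite mem_enum inE => /andP[_ /asboolP hl] ->.
    move=> /mapP[l']; rewrite mem_enum inE => /andP[_ /asboolP hl'] ->.
    have := conf _ _ _ hl hl'; rewrite /pt /point !ffunE eqxx; apply.
    by move=> j /negbTE jj0; rewrite !ffunE jj0.
pose G := [pred f | (f \in fam) && ~~ bad f].
have cardfam := card_points o SM R.
have volG : volume n <= loss * #|G|%:R * volume n.+1.
  apply: (@le_trans _ _ (\prod_j ((size (S j))%:R * (b / a * 4 `^ delta j) * rho n.+1 j `^ delta j))).
    apply: ler_prod => j _; rewrite powR_ge0 /=.
    have [_ _ _ lb] := hS j; have rp := rho0 n.+1 j; have tp := rho0 n j.
    have t4 : 0 < rho n j / 4 by rewrite divr_gt0.
    have e2 : rho n j / 2 = 2 * (rho n j / 4) by field.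
    move: lb; rewrite e2 [in leLHS]powRM ?(ltW t4)// [in leRHS]powRM ?(ltW rp)// => lb.
    rewrite [in leLHS](_ : rho n j = 4 * (rho n j / 4)); last by field.
    rewrite powRM ?(ltW t4)//.
    have p2 : 0 < 2 `^ delta j :> R by rewrite powR_gt0.
    have p4 : 0 < 4 `^ delta j :> R by rewrite powR_gt0.
    rewrite -(ler_pM2l a_gt0) -(ler_pM2l p2).
    move: lb p2 p4; set u2 := 2 `^ _; set u4 := 4 `^ _; set v := (_ / 4) `^ _; set w := _ `^ _ => lb p2 p4.
    rewrite (_ : _ * (a * (u4 * v)) = u4 * (a * (u2 * v))); last by ring.
    rewrite (_ : u2 * (a * _) = u4 * ((size (S j))%:R * (b * (u2 * w)))); last by field; rewrite gt_eqF.
    by rewrite ler_pM2l.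
  rewrite !big_split /= -cardfam /loss /volume.
  rewrite ler_wpM2r ?(ltW (volume_gt0 _))//.
  rewrite -!big_split /= [leRHS]mulrAC ler_wpM2r //.
    by apply: prodr_ge0 => j _; rewrite mulr_ge0 ?powR_ge0 ?divr_ge0 ?ltW.
  by rewrite -natrM ler_nat.
have G0 : (0 < #|G|)%N.
  rewrite lt0n; apply/negP => /eqP e; move: volG.
  by rewrite e mulr0 mul0r leNgt volume_gt0.
have sum_le l : \sum_(f | G f) weight n.+1 (pt f) l <= #|G|%:R * weight n x l.
  have [nl|nl] := leqP n.+1 (lev l); last first.
    rewrite big1 ?mulr_ge0 ?weight_ge0 // => f _; rewrite /weight leqNgt nl //.
  rewrite /weight nl (ltnW nl) -mulr_sumr -mulr_suml.
  set ms := \prod_j mass (m j) (cball (x j) _ `&` _).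
  have ms0 : 0 <= ms by apply: prodr_ge0 => j _; exact: mass_ge0.
  have le_ms : \sum_(f | G f) \prod_j mass (m j) (cball (pt f j) (rho n.+1 j) `&` B l j) <= ms.
    apply: (@le_trans _ _ (\sum_(f in fam) \prod_j mass (m j) (cball (pt f j) (rho n.+1 j) `&` B l j))).
      rewrite big_mkcond [leRHS]big_mkcond /=; apply: ler_sum => f _.
      case: (f \in fam) => //=; case: ifP => // _.
      by apply: prodr_ge0 => j _; exact: mass_ge0.
    rewrite -(prod_sum_points o SM (fun j y => mass (m j) (cball y (rho n.+1 j) `&` B l j))).
    apply: ler_prod => j _; rewrite sumr_ge0 /=; last by move=> y _; exact: mass_ge0.
    have [uS SO sS _] := hS j.
    apply: sum_mass_le => //; first exact: measurable_cball.
    move=> y /SO[_ yx] z; rewrite /cball /= => zy.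
    by have := cdist_triangle y z (x j); have := rho_half n j; lra.
  (* One factor [loss] is spent in passing to level [n.+1], by [volG]. *)
  rewrite -(subnSK nl) exprS.
  have lp : 0 < loss ^+ (lev l - n.+1) by rewrite exprn_gt0 ?loss_gt0.
  rewrite (_ : _ * (loss * _ * _) = loss ^+ (lev l - n.+1) * (#|G|%:R * loss * (ms / volume n))); last by ring.
  rewrite ler_pM2l // ler_pdivrMr ?volume_gt0//.
  apply: le_trans le_ms _.
  rewrite -[leLHS]mulr1 [leRHS](_ : _ = ms * (loss * #|G|%:R * volume n.+1 / volume n)); last by ring.
  by rewrite ler_wpM2l // ler_pdivlMr ?volume_gt0// mul1r.
have [f Gf lt_f] := averaging G0 (weight_ge0 n x) (fun f => weight_ge0 n.+1 (pt f)) sum_le lt_theta.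
move: Gf => /andP[fF /asboolP nbad].
exists (pt f); split => // j; have [_ SO _ _] := hS j; have [] := SO _ (point_in o j fF) => //.
Qed.

End Potential.

(** * Bad approximability of the limit, and the lower bound for covering sums *)

Lemma prod_powR (I : finType) (P : pred I) (u : R) (f : I -> R) : 0 < u ->
  \prod_(j | P j) u `^ f j = u `^ (\sum_(j | P j) f j).
Proof.
move=> u0; apply: (big_ind2 (fun v w => v = u `^ w)) => //; first by rewrite powRr0.
by move=> v1 w1 v2 w2 -> ->; rewrite powR_addr.
Qed.

Let s_small : s < 1.
Proof.
have h := small; have k1' := k1; have s0' := s0.
have f1 : 1 <= (N.+1)`!%:R :> R by rewrite ler1n; exact: fact_gt0.
have k21 : 1 <= k ^+ 2 by rewrite exprn_ege1 // ltW.
have h2 : s <= 2 * s * k ^+ 2 by nra.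
apply: le_lt_trans h2 (le_lt_trans _ h); rewrite ler_peMl //; nra.
Qed.

(** A violation by [q] with [k^n <= |q| < k^(n+1)] would give
    [|q * z j - p j| <= (s / k) * |q|^(- i j)], which is at most [|q| * rho n j / k]: a danger at
    level [n]. *)
Lemma avoid_danger_Bad (x : nat -> 'I_N -> C R) z :
  (forall n j, cdist (z j) (x n j) <= rho n j) ->
  (forall n, ~ meets_danger i k s n (x n) (x n.+1)) -> BadC i z.
Proof.
move=> zx avoid.
have sk0 : 0 < s / k by rewrite divr_gt0.
have sk1 : s / k <= 1 by rewrite ler_pdivrMr // mul1r; have := s_small; have := k1; lra.
(* Every factor is at most 1, so [c^(i j) <= s / k] holds for all positive weights at once. *)
pose c := \prod_(j < N | i j != 0) (s / k) `^ (i j)^-1.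
have c0 : 0 < c by apply: prodr_gt0 => j _; rewrite powR_gt0.
exists c => // q p gq gp q0; rewrite leNgt; apply/negP => lt_max.
have q1 := gauss_int_norm_ge1 gq q0; have qp : 0 < cnorm q by exact: lt_le_trans q1.
have [n /andP[n1 n2]] := exists_level k2 q1.
apply: (avoid n); exists z; split=> //.
exists q, p; split=> //; first by rewrite n1 ltW.
move=> j ij.
have ijp : 0 < i j by rewrite lt_neqAle eq_sym ij i0.
set X := cnorm _.
have X0 : 0 <= X by exact: sqrtr_ge0.
have hX : X `^ (i j)^-1 < c * (cnorm q)^-1.
  apply: le_lt_trans lt_max.
  exact: (le_bigmax_cond 0 (P := fun j => i j != 0)
    (fun j => cnorm (csub (cmul q (z j)) (p j)) `^ (i j)^-1)).
have {}hX : X <= (c * (cnorm q)^-1) `^ i j.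
  rewrite -[leLHS]powRr1 // -(mulVf ij) powRrM.
  by apply: ge0_ler_powR; rewrite ?nnegrE ?powR_ge0 ?(ltW ijp) ?(ltW hX)// mulr_ge0 ?invr_ge0 ?(ltW c0) ?(ltW qp).
apply: le_trans hX _.
have hc : c `^ i j <= s / k.
  have -> : s / k = ((s / k) `^ (i j)^-1) `^ i j.
    by rewrite -powRrM mulVf // powRr1 // ltW.
  apply: ge0_ler_powR; rewrite ?nnegrE ?powR_ge0 ?(ltW c0) ?(ltW ijp)//.
  rewrite /c (bigD1 j) //= ler_piMr ?powR_ge0//.
  apply: prodr_ile1 => l _; rewrite powR_ge0 /= -(powRr0 (s / k)).
  by apply: ger_powR; rewrite ?sk0 ?invr_ge0.
rewrite powRM ?(ltW c0) ?invr_ge0 ?(ltW qp)//.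
rewrite (_ : rho n j / k = s / k * ratio i k j ^+ n); last by rewrite /rho /radius mulrAC.
rewrite mulrCA; apply: ler_pM; rewrite ?powR_ge0//.
rewrite -ler_pdivrMl //.
have -> : (cnorm q)^-1 * (cnorm q)^-1 `^ i j = (cnorm q) `^ (- (1 + i j)).
  by rewrite -[(cnorm q)^-1]powR_inv1 ?(ltW qp)// -powRrM -powR_addr // mulN1r opprD.
have -> : ratio i k j ^+ n = (k ^+ n) `^ (- (1 + i j)).
  by rewrite -(powR_mulrn n (powR_ge0 _ _)) -(powR_mulrn n (ltW k0)) powRAC.
have kn : 0 < k ^+ n by rewrite exprn_gt0.
rewrite !powRN lef_pV2 ?posrE ?powR_gt0//.
by apply: ge0_ler_powR; rewrite ?nnegrE ?addr_ge0 ?(ltW kn) ?(ltW qp).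
Qed.
Let Omega := [set z : 'I_N -> C R | forall j, Om j (z j)].
Let D := \sum_j delta j.

Definition cover_mass := \prod_j (b * 3 `^ delta j).

Lemma cover_mass_gt0 : 0 < cover_mass.
Proof. by apply: prodr_gt0 => j _; rewrite mulr_gt0 ?powR_gt0. Qed.

(** Condition (A) bounds the discs of radius [3 * s / k^n]; the powers of [s] form [volume 0], and
    each level leaves a factor [k^(-D)] against one [loss]. *)
Lemma cover_ball_mass x0 y n : 3 * s <= r0 -> (forall j, Om j (y j)) ->
  loss ^+ n * (\prod_j mass (m j) (cball (x0 j) (rho 0 j) `&` cball (y j) (3 * (s / k ^+ n)))
     / volume 0) <= cover_mass * (loss * k `^ (- D)) ^+ n.
Proof.
move=> s3 Oy; rewrite [in leRHS]exprMn [leRHS]mulrCA ler_pM2l ?exprn_gt0 ?loss_gt0//.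
rewrite ler_pdivrMr ?volume_gt0//.
have kn : 0 < k ^+ n by rewrite exprn_gt0.
have -> : k `^ (- D) ^+ n = \prod_j (k `^ (- delta j)) ^+ n.
  by rewrite prodrXl prod_powR // sumrN.
rewrite /cover_mass /volume -!big_split /=; apply: ler_prod => j _.
rewrite mass_ge0 /=.
have sk : 0 < s / k ^+ n by rewrite divr_gt0.
have skr : 3 * (s / k ^+ n) <= r0.
  apply: (le_trans _ s3); rewrite ler_pM2l // ler_pdivrMr // ler_peMr ?(ltW s0)//.
  by rewrite exprn_ege1 // ltW.
apply: (@le_trans _ _ (mass (m j) (cball (y j) (3 * (s / k ^+ n))))).
  by apply: mass_le => //; first (by apply: measurableI; exact: measurable_cball); exact: measurable_cball.
apply: le_trans (mass_ub (m_fin j) (@condA_ub j) (Oy j) _ skr) _; first by rewrite mulr_gt0.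
rewrite /rho /radius expr0 mulr1 -!mulrA ler_pM2l // le_eqVlt; apply/orP; left; apply/eqP.
rewrite powRM ?(ltW sk)//; congr (_ * _).
rewrite powRM ?invr_ge0 ?(ltW s0) ?(ltW kn)// mulrC; congr (_ * _).
rewrite -[(k ^+ n)^-1]powR_inv1 ?(ltW kn)// -powRrM mulN1r.
by rewrite -(powR_mulrn n (powR_ge0 k _)) -(powR_mulrn n (ltW k0)) powRAC.
Qed.

(** A smaller sum would start the potential below [a^N], where good children keep it for ever. The
    limit point lies in some [F l], and at level [lv l] that set alone has weight at least [a^N]. *)
Lemma cover_sum_ge (t eps : R) (F : nat -> set ('I_N -> C R)) :
  Omega !=set0 -> 3 * s <= r0 -> 0 <= t -> loss * k `^ (- D) <= k `^ (- t) / 2 ->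
  BadC i `&` Omega `<=` \bigcup_l F l ->
  (forall l, (diam (@distCN R N) (F l) <= s%:E)%E) ->
  0 < eps -> cover_mass * (k `^ t * s `^ (- t) + 1) * eps < a ^+ N ->
  (eps%:E <= \sum_(l <oo) hterm (@distCN R N) t (F l))%E.
Proof.
move=> [x0 Ox0] s3 t0 lam_le cov Fs eps0 eps_lt.
rewrite leNgt; apply/negP => sum_lt.
set lam := loss * _ in lam_le; pose e l := eps / (2 ^ l.+1)%:R.
have e_gt0 l : 0 < e l by rewrite divr_gt0 // ltr0n expn_gt0.
pose K := cover_mass * (k `^ t * s `^ (- t)).
have K0 : 0 <= K by rewrite mulr_ge0 ?(ltW cover_mass_gt0)// mulr_ge0 ?powR_ge0.
have h0 l : (0 <= hterm (@distCN R N) t (F l))%E.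
  by rewrite /hterm; case: ifP => // _; rewrite lee_fin powR_ge0.
have d0 l : (0 <= diam (@distCN R N) (F l))%E by apply: ereal_sup_ubound; left.
have dfin l : diam (@distCN R N) (F l) = (fine (diam (@distCN R N) (F l)))%:E.
  by rewrite fineK // ge0_fin_numE //; apply: le_lt_trans (Fs l) _; rewrite ltry.
pose P l (nB : nat * ('I_N -> set (C R))) :=
  [/\ forall j, measurable (nB.2 j),
     ((loss ^+ nB.1 * (\prod_j mass (m j) (cball (x0 j) (rho 0 j) `&` nB.2 j) / volume 0))%:E
       <= K%:E * hterm (@distCN R N) t (F l) + (cover_mass * eps / (2 ^ l.+1)%:R)%:E)%E &
     forall z x, F l z -> Omega z -> (forall j, cdist (z j) (x j) <= rho nB.1 j) ->
       forall j, cball (x j) (rho nB.1 j) `<=` nB.2 j].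
have [nB hnB] : {nB : nat -> nat * ('I_N -> set (C R)) & forall l, P l (nB l)}.
  apply: choice => l.
  have [[y [Fy Oy]]|nFO] := EM (F l `&` Omega !=set0); last first.
    (* A set missing [Omega] cannot contain the limit point; empty factors give it weight 0. *)
    exists (0%N, fun=> set0); split => /=; first by move=> _; exact: measurable0.
      have [j1 _] := exists_weight i1.
      rewrite (bigD1 j1) //= setI0 /mass measure0 /= mul0r mul0r mulr0.
      rewrite adde_ge0 ?mule_ge0 ?lee_fin// divr_ge0 // mulr_ge0 ?(ltW eps0)//.
      exact: ltW cover_mass_gt0.
    by move=> z x Fz Oz; exfalso; apply: nFO; exists z.
  set d := fine (diam (@distCN R N) (F l)).
  have dge0 : 0 <= d by rewrite fine_ge0.
  have ds : d <= s by rewrite -lee_fin -dfin.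
  have lam0 : 0 <= lam by rewrite mulr_ge0 ?powR_ge0 // ltW // loss_gt0.
  have [n [dn lamn]] := exists_cover_level k2 s0 t0 lam0 lam_le dge0 ds (e_gt0 l).
  (* The 3 adds the distance from [y] to [z], from [z] to the centre [x], and the radius about [x],
     each at most [s / k^n]. *)
  exists (n, fun j => cball (y j) (3 * (s / k ^+ n))); split => /=.
  - by move=> j; exact: measurable_cball.
  - have -> : hterm (@distCN R N) t (F l) = (d `^ t)%:E.
      by rewrite /hterm ifF //; apply/eqP => F0; move: Fy; rewrite F0.
    rewrite -EFinM -EFinD lee_fin; apply: le_trans (cover_ball_mass x0 n s3 Oy) _.
    rewrite (_ : K * d `^ t + _ = cover_mass * (k `^ t * s `^ (- t) * d `^ t + e l)); last by rewrite /K /e; ring.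
    by rewrite ler_pM2l ?cover_mass_gt0.
  - move=> z x Fz Oz zx j w; rewrite /cball /= => wx.
    have zy : cdist (z j) (y j) <= d.
      apply: le_trans (cdist_le_distCN z y j) _; rewrite -lee_fin -dfin.
      by apply: ereal_sup_ubound; right; exists (z, y).
    have rn : rho n j <= s / k ^+ n.
      rewrite /rho /radius ler_pM2l // -exprVn.
      by apply: lerXn2r; rewrite ?nnegrE ?invr_ge0 ?(ltW k0) ?(ltW (ratio_gt0 i k1 j))// ratio_le.
    have := cdist_triangle (x j) w (y j); have := cdist_triangle (z j) (x j) (y j).
    by have := zx j; rewrite (cdistC (x j) (z j)); lra.
pose Bl l := (nB l).2; pose lv l := (nB l).1.
have mBl l j : measurable (Bl l j) by have [h _ _] := hnB l; exact: h.
have start : (\sum_(l <oo) (weight Bl lv 0 x0 l)%:E < (a ^+ N)%:E)%E.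
  (* [K * eps] stems from the cover and [cover_mass * eps] from the slacks; the [+ 1] in the
     hypothesis on [eps] allows for the latter. *)
  apply: (@le_lt_trans _ _ (K * eps + cover_mass * eps)%:E); last first.
    by rewrite lte_fin; apply: le_lt_trans eps_lt; rewrite /K; lra.
  apply: (@le_trans _ _ (\sum_(l <oo) (K%:E * hterm (@distCN R N) t (F l) + (cover_mass * eps / (2 ^ l.+1)%:R)%:E))%E).
    apply: lee_nneseries => [l _ _|l _]; first by rewrite lee_fin weight_ge0.
    by have [_ h _] := hnB l; rewrite /weight leq0n subn0.
  apply: le_trans (epsilon_trick _ _ _) _.
  - by move=> l; rewrite mule_ge0 ?lee_fin.
  - by rewrite mulr_ge0 ?(ltW eps0) ?(ltW cover_mass_gt0).
  rewrite EFinD leeD2r // nneseriesZl; last by move=> l _; exact: h0.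
  by rewrite (EFinM K eps) lee_wpmul2l ?lee_fin // ltW.
pose Inv n x := (forall j, Om j (x j)) /\ (\sum_(l <oo) (weight Bl lv n x l)%:E < (a ^+ N)%:E)%E.
pose Next n x x' := [/\ forall j, cdist (x' j) (x j) <= rho n j / 2 & ~ meets_danger i k s n x x'].
(* [g] is total, returning the old centre where the invariant fails. *)
have [g hg] : {g : nat * ('I_N -> C R) -> 'I_N -> C R &
    forall nx, Inv nx.1 nx.2 -> Inv nx.1.+1 (g nx) /\ Next nx.1 nx.2 (g nx)}.
  apply: (@choice _ _ (fun nx x' => Inv nx.1 nx.2 -> Inv nx.1.+1 x' /\ Next nx.1 nx.2 x')) => -[n x] /=.
  have [[Ox lt_x]|nI] := EM (Inv n x); last by exists x.
  have [x' [h1 h2 h3 h4]] := exists_good_child mBl Ox lt_x.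
  by exists x' => _; exact: (conj (conj h1 h4) (conj h2 h3)).
pose x := fix x n := if n is n'.+1 then g (n', x n') else x0.
have Inv_x n : Inv n (x n).
  elim: n => [|n ih]; first exact: (conj Ox0 start).
  exact: (proj1 (hg (n, x n) ih)).
have Next_x n : Next n (x n) (x n.+1) by exact: (proj2 (hg (n, x n) (Inv_x n))).
have [z hz] : {z : 'I_N -> C R & forall j, Om j (z j) /\ forall n, cdist (z j) (x n j) <= rho n j}.
  apply: (@choice _ _ (fun j w => Om j w /\ forall n, cdist w (x n j) <= rho n j)) => j.
  have Oxj n : Om j (x n j) by have [h _] := Inv_x n; exact: h.
  have xxj n : cdist (x n.+1 j) (x n j) <= rho n j / 2 by have [h _] := Next_x n; exact: h.
  by have [w Ow hw] := nested_limit (@cOm j) Oxj xxj (rho_half ^~ j); exists w.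
have Oz : Omega z by move=> j; have [] := hz j.
have zx n j : cdist (z j) (x n j) <= rho n j by have [_ h] := hz j; exact: h.
have Bz : BadC i z by apply: avoid_danger_Bad zx _ => n; have [] := Next_x n.
have [l _ Fz] := cov z (conj Bz Oz).
have [_ _ sub] := hnB l.
have [Ox lt_x] := Inv_x (lv l).
(* The rectangle contains the point [z] of [F l], so it lies within [Bl l]; its factors are masses
   of full discs and no [loss] is left. *)
have ge_w : a ^+ N <= weight Bl lv (lv l) (x (lv l)) l.
  rewrite /weight leqnn subnn expr0 mul1r ler_pdivlMr ?volume_gt0//.
  have -> : a ^+ N = \prod_(j < N) a by rewrite prodr_const card_ord.
  rewrite /volume -big_split /=; apply: ler_prod => j _.
  rewrite mulr_ge0 ?powR_ge0 ?(ltW a_gt0)//= setIidl; last exact: sub Fz Oz (zx _) j.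
  by apply: (mass_lb (m_fin j) (@condA_lb j)).
move: lt_x; apply/negP; rewrite -leNgt.
apply: (@le_trans _ _ (weight Bl lv (lv l) (x (lv l)) l)%:E); first by rewrite lee_fin.
apply: le_trans (nneseries_lim_ge l.+1 _); last by move=> *; rewrite lee_fin weight_ge0.
rewrite big_nat_recr //= leeDr // sume_ge0 // => l' _; by rewrite lee_fin weight_ge0.
Qed.

End Step.

Import Normc.

(** * Elementary properties of Hausdorff content and dimension *)

Section HausdorffMonotone.
Variables (R : realType) (T : Type) (d : T -> T -> R).
Implicit Types (A B : set T) (s t : R).

Lemma hterm_ge0 s A : (0 <= hterm d s A)%E.
Proof. by rewrite /hterm; case: ifP => // _; rewrite lee_fin powR_ge0. Qed.

Lemma haus_content_ge0 s t A : (0 <= haus_content d s t A)%E.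
Proof.
apply: le_ereal_inf_tmp => _ [F _ <-]; apply: nneseries_ge0 => l _ _; exact: hterm_ge0.
Qed.

Lemma haus_content_le s t A B : A `<=` B ->
  (haus_content d s t A <= haus_content d s t B)%E.
Proof.
move=> AB; apply: le_ereal_inf_tmp => _ [F [BF Fd] <-]; apply: ereal_inf_lbound.
by exists F => //; split => //; exact: subset_trans BF.
Qed.

Lemma hausdorff_measure_eq0 s A :
  hausdorff_measure d s A = 0%E <-> forall t, 0 < t -> (haus_content d s t A <= 0)%E.
Proof.
split=> [h t t0|h].
  by rewrite -h; apply: ereal_sup_ubound; exists t.
apply/eqP; rewrite eq_le; apply/andP; split.
  by apply: ge_ereal_sup => _ [t t0 <-]; exact: h.
apply: (@le_trans _ _ (haus_content d s 1 A)); first exact: haus_content_ge0.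
by apply: ereal_sup_ubound; exists 1 => //=; exact: ltr01.
Qed.

Lemma hausdorff_dim_le A B : A `<=` B -> (hausdorff_dim d A <= hausdorff_dim d B)%E.
Proof.
move=> AB; apply: le_ereal_inf_tmp => _ [s [s0 /hausdorff_measure_eq0 h] <-].
apply: ereal_inf_lbound; exists s => //; split=> //.
apply/hausdorff_measure_eq0 => t t0; apply: le_trans (h t t0).
exact: haus_content_le.
Qed.

(** The family is enumerated and continued by empty sets, whose [hterm] is 0 even for exponent 0. *)
Lemma haus_content_finite_cover (s t : R) (I : finType) (P : pred I) (E : I -> set T) A u :
  0 <= u -> A `<=` \bigcup_(f in [set f | P f]) E f ->
  0 <= t -> (forall f, P f -> (diam d (E f) <= t%:E)%E /\ (hterm d s (E f) <= u%:E)%E) ->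
  (haus_content d s t A <= (#|P|%:R * u)%:E)%E.
Proof.
move=> u0 cov t0 hE.
pose F l := if onth (enum P) l is Some f then E f else set0.
have FE l f : onth (enum P) l = Some f -> P f.
  by move=> h; rewrite -[P f]/(f \in P) -mem_enum; apply/onthP; exists l.
have sumF : (\sum_(l <oo) hterm d s (F l) <= (#|P|%:R * u)%:E)%E.
  rewrite (nneseries_split 0 #|P|); last by move=> l _; exact: hterm_ge0.
  rewrite add0n [X in (_ + X)%E]eseries0 ?adde0; last first.
    by move=> l hl _; rewrite /F onth_default -?cardE // /hterm eqxx.
  have -> : (#|P|%:R * u)%:E = (\sum_(0 <= l < #|P|) u%:E)%E.
    by rewrite sumEFin sumr_const_nat subn0 mulr_natl.
  apply: lee_sum => l _; rewrite /F; case E1: (onth _ _) => [f|].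
    by have [] := hE f (FE _ _ E1).
  by rewrite /hterm eqxx lee_fin.
apply: le_trans sumF; apply: ereal_inf_lbound; exists F => //; split.
  move=> z /cov[f /= Pf Ez]; exists (index f (enum P)) => //.
  have fP : f \in enum P by rewrite mem_enum.
  rewrite /F; case E1: (onth _ _) => [g|].
    have eg : nth f (enum P) (index f (enum P)) = g by apply: onth_nth.
    by rewrite -eg nth_index.
  by have := onthTE (enum P) (index f (enum P)); rewrite E1 index_mem fP.
move=> l; rewrite /F; case E1: (onth _ _) => [f|]; first by have [] := hE f (FE _ _ E1).
by apply: ge_ereal_sup => x [->|[[y z] [[]]]]; rewrite lee_fin.
Qed.

End HausdorffMonotone.

Lemma powR_invK (R : realType) (x e : R) : e != 0 -> 0 <= x -> (x `^ e^-1) `^ e = x.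
Proof. by move=> e0 x0; rewrite -powRrM mulVf // powRr1. Qed.

(** * Both bounds for the dimension *)

Section Dimension.
Variables (R : realType) (N : nat) (Om : 'I_N -> set (C R)).
Variables (m : 'I_N -> {measure set (C R) -> \bar R}) (delta : 'I_N -> R) (r0 a b : R).
Hypotheses (m_fin : forall j, (m j setT < +oo)%E) (m_Om : forall j, m j (~` Om j) = 0%E).
Hypothesis cOm : forall j, compact (Om j).
Hypotheses (r0_gt0 : 0 < r0) (a_gt0 : 0 < a) (b_gt0 : 0 < b).
Hypothesis condA_lb : forall j c r, Om j c -> 0 < r -> r <= r0 ->
  ((a * r `^ delta j)%:E <= m j (cball c r))%E.
Hypothesis condA_ub : forall j c r, Om j c -> 0 < r -> r <= r0 ->
  (m j (cball c r) <= (b * r `^ delta j)%:E)%E.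
Hypothesis delta_gt0 : forall j, 0 < delta j.

Let Omega := [set z : 'I_N -> C R | forall j, Om j (z j)].
Let D := \sum_j delta j.

(** Coordinate nets have at most [mass / (a * r^delta)] points; products of their discs of radius
    [2 * r] cover [Omega] and have diameter at most [4 * r] in the maximum metric. *)
Lemma haus_content_product_le r t : 0 < r -> r <= r0 -> 0 <= t ->
  (haus_content (@distCN R N) t (4 * r) Omega <=
    (\prod_j (mass (m j) setT / a) * 4 `^ t * r `^ (t - D))%:E)%E.
Proof.
move=> rp rr t0.
pose Q (j : 'I_N) (S : seq (C R)) := (size S)%:R * (a * r `^ delta j) <= mass (m j) setT /\
  (forall y, Om j y -> exists2 x, x \in S & cdist y x <= 2 * r).
have [S hS] : {S : 'I_N -> seq (C R) & forall j, Q j (S j)}.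
  apply: choice => j.
  have [S [uS SO sS cov]] :=
    maximal_separated (m_fin j) a_gt0 (@condA_lb j) (@subset_refl _ (Om j)) rp rr.
  exists S; split => //.
  by apply: (size_separated_le (m_fin j) (@condA_lb j) uS sS rp rr measurableT) => x /SO.
pose M := (\max_j size (S j))%N.
have SM j : (size (S j) <= M)%N by exact: (leq_bigmax j).
pose o : C R := (0, 0).
pose E (f : {ffun 'I_N -> 'I_M}) := [set z : 'I_N -> C R | forall j, cdist (z j) (point o S f j) <= 2 * r].
have r4 : 0 <= 4 * r by rewrite mulr_ge0 // ltW.
have dE f : (diam (@distCN R N) (E f) <= (4 * r)%:E)%E.
  apply: ge_ereal_sup => x [->|[[y z] [/= Ey Ez] <-]]; rewrite lee_fin //.
  apply: distCN_le => // j; have := cdist_triangle (point o S f j) (y j) (z j).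
  by have := Ey j; have := Ez j; rewrite (cdistC (z j)); lra.
apply: le_trans (@haus_content_finite_cover R _ (@distCN R N) t (4 * r) _
  (mem (family (index_in (M := M) S))) E Omega ((4 * r) `^ t) (powR_ge0 _ _) _ r4 _) _.
- move=> z Oz.
  have [f hf] : {f : 'I_N -> 'I_M & forall j, (f j < size (S j))%N /\ cdist (z j) (nth o (S j) (f j)) <= 2 * r}.
    apply: (@choice _ _ (fun j l => (nat_of_ord l < size (S j))%N /\ cdist (z j) (nth o (S j) l) <= 2 * r)) => j.
    have [_ /(_ _ (Oz j))[x xS zx]] := hS j.
    have lt1 : (index x (S j) < size (S j))%N by rewrite index_mem.
    by exists (Ordinal (leq_trans lt1 (SM j))) => /=; rewrite nth_index.
  exists [ffun j => f j] => /=.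
    by apply/familyP => j; rewrite ffunE; have [] := hf j.
  by move=> j; rewrite /point ffunE; have [] := hf j.
- move=> f _; split; first exact: dE.
  rewrite /hterm; case: ifP => _; rewrite lee_fin ?powR_ge0//.
  have d0 : (0 <= diam (@distCN R N) (E f))%E by apply: ereal_sup_ubound; left.
  apply: ge0_ler_powR; rewrite ?nnegrE ?fine_ge0//.
  by rewrite -lee_fin fineK // ge0_fin_numE //; apply: le_lt_trans (dE f) _; rewrite ltry.
rewrite lee_fin (card_points o SM R) powRM ?(ltW rp)//.
have -> : \prod_j (mass (m j) setT / a) * 4 `^ t * r `^ (t - D) =
    (\prod_j (mass (m j) setT / a) * r `^ (- D)) * (4 `^ t * r `^ t).
  by rewrite powR_addr //; ring.
rewrite ler_wpM2r ?mulr_ge0 ?powR_ge0//.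
have -> : r `^ (- D) = \prod_j r `^ (- delta j) by rewrite prod_powR // sumrN.
rewrite -big_split /=; apply: ler_prod => j _; rewrite ler0n /=.
have [h _] := hS j.
rewrite powRN -mulrA -invfM ler_pdivlMr // mulr_gt0 ?powR_gt0//.
Qed.

Lemma hausdorff_dim_product_le : (hausdorff_dim (@distCN R N) Omega <= D%:E)%E.
Proof.
have D0 : 0 <= D by apply: sumr_ge0 => j _; exact: ltW.
apply/lee_addgt0Pr => e e0; rewrite -EFinD; set t := D + e.
have t0 : 0 <= t by rewrite addr_ge0 // ltW.
apply: ereal_inf_lbound; exists t => //; split=> //.
apply/hausdorff_measure_eq0 => u u0; apply/lee_addgt0Pr => eps eps0; rewrite add0e.
set c := \prod_j (mass (m j) setT / a) * 4 `^ t.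
have c0 : 0 <= c.
  rewrite mulr_ge0 ?powR_ge0 //; apply: prodr_ge0 => j _.
  by rewrite divr_ge0 ?mass_ge0 ?ltW.
(* The three terms ensure [r <= r0], [4 * r <= u] and [c * r^e <= eps]; the 1 in [c + 1] avoids
   dividing by 0. *)
pose r := Num.min (Num.min r0 (u / 4)) ((eps / (c + 1)) `^ e^-1).
have c1 : 0 < c + 1 by rewrite ltr_wpDl.
have rp : 0 < r by rewrite !lt_min r0_gt0 divr_gt0 //= powR_gt0 // divr_gt0.
have rr : r <= r0 by rewrite /r ge_min ge_min lexx.
have ru : r <= u / 4 by rewrite /r ge_min ge_min lexx orbT.
have re : r <= (eps / (c + 1)) `^ e^-1 by rewrite /r ge_min lexx orbT.
apply: (@le_trans _ _ (haus_content (@distCN R N) t (4 * r) Omega)).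
  apply: ereal_inf_le_tmp => _ [F [cov Fd] <-]; exists F => //; split=> // l.
  by apply: le_trans (Fd l) _; rewrite lee_fin; lra.
apply: le_trans (haus_content_product_le rp rr t0) _; rewrite lee_fin -/c.
have -> : t - D = e by rewrite /t addrC addKr.
have h : r `^ e <= eps / (c + 1).
  rewrite -[leRHS](powR_invK (lt0r_neq0 e0)) ?divr_ge0 ?(ltW eps0) ?(ltW c1)//.
  by apply: ge0_ler_powR; rewrite ?nnegrE ?powR_ge0 ?(ltW rp) ?(ltW e0).
apply: le_trans (ler_wpM2l c0 h) _.
by rewrite mulrCA ler_piMr ?(ltW eps0)// ler_pdivrMr // mul1r lerDl.
Qed.

Variable i : 'I_N -> R.
Hypotheses (i0 : forall j, 0 <= i j) (i1 : \sum_j i j = 1).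

(** [k] is a sum exceeding every threshold. The last condition amounts to [2 * loss <= k^(D - t)],
    solvable as [t < D] and [loss] is free of [k]. *)
Lemma exists_base t : t < D -> exists k, [/\ 2 <= k, 8 * N%:R <= k,
  forall j, (32 * N%:R / k) `^ delta j <= a ^+ 2 / (2 * b ^+ 2) &
  loss delta a b * k `^ (- D) <= k `^ (- t) / 2].
Proof.
move=> tD; have tD0 : 0 < D - t by rewrite subr_gt0.
set q := a ^+ 2 / (2 * b ^+ 2).
have q0 : 0 < q by rewrite divr_gt0 ?mulr_gt0 ?exprn_gt0.
pose K j := 32 * N%:R / q `^ (delta j)^-1.
have K0 j : 0 <= K j by rewrite divr_ge0 ?powR_ge0 // mulr_ge0.
pose K' := (2 * loss delta a b) `^ (D - t)^-1.
have K'0 : 0 <= K' by exact: powR_ge0.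
pose k := 2 + 8 * N%:R + \sum_j K j + K'.
have sK0 : 0 <= \sum_j K j by apply: sumr_ge0.
have N0 : 0 <= N%:R :> R by [].
have k0 : 0 < k by rewrite /k; lra.
have l0 : 0 < loss delta a b by exact: loss_gt0.
exists k; split; [by rewrite /k; lra|by rewrite /k; lra|move=> j|].
  have Kk : K j <= k.
    have : K j <= \sum_j K j by rewrite (bigD1 j) //= lerDl sumr_ge0.
    by rewrite /k; lra.
  have qd : 0 < q `^ (delta j)^-1 by rewrite powR_gt0.
  have h : 32 * N%:R / k <= q `^ (delta j)^-1.
    by rewrite ler_pdivrMr // [leRHS]mulrC -ler_pdivrMr.
  rewrite -[leRHS](powR_invK (lt0r_neq0 (delta_gt0 j))) ?(ltW q0)//.
  by apply: ge0_ler_powR; rewrite ?nnegrE ?powR_ge0 ?(ltW (delta_gt0 j))// divr_ge0 ?mulr_ge0 ?(ltW k0).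
have h : 2 * loss delta a b <= k `^ (D - t).
  have l2 : 0 <= 2 * loss delta a b by lra.
  rewrite -[leLHS](powR_invK (lt0r_neq0 tD0) l2).
  apply: ge0_ler_powR; rewrite ?nnegrE ?powR_ge0 ?(ltW tD0) ?(ltW k0)//.
  by rewrite -/K' /k; lra.
have -> : k `^ (- t) = k `^ (D - t) * k `^ (- D).
  by rewrite -powR_addr //; congr (_ `^ _); ring.
rewrite [leRHS]mulrAC ler_wpM2r ?powR_ge0// ler_pdivlMr // mulrC; exact: h.
Qed.

(** For [t < D] with vanishing measure, [k] is chosen from [t], then [s] from [k], then [eps]; a
    cover with sum below [eps] contradicts [cover_sum_ge]. *)
Lemma hausdorff_dim_Bad_ge : Omega !=set0 ->
  (D%:E <= hausdorff_dim (@distCN R N) (BadC i `&` Omega))%E.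
Proof.
move=> O0; apply: le_ereal_inf_tmp => _ [t [t0 /hausdorff_measure_eq0 Ht] <-].
rewrite lee_fin leNgt; apply/negP => tD.
have [k [k2 kN k_large k_loss]] := exists_base tD.
have k0 : 0 < k by lra.
have f0 : 0 < (N.+1)`!%:R :> R by rewrite ltr0n fact_gt0.
(* The 4 in place of 2 makes the smallness condition strict even for [s = c^-1]. *)
pose c := (N.+1)`!%:R * (4 * k ^+ 2).
have c0 : 0 < c by rewrite !mulr_gt0 ?exprn_gt0.
pose s := Num.min (r0 / 3) c^-1.
have s0 : 0 < s by rewrite lt_min divr_gt0 ?invr_gt0.
have s3 : 3 * s <= r0.
  have : s <= r0 / 3 by rewrite ge_min lexx.
  lra.
have sr0 : s <= r0 by lra.
have small : (N.+1)`!%:R * (2 * s * k ^+ 2) < 1.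
  have sc : s * c <= 1.
    by rewrite -ler_pdivlMr // mul1r ge_min lexx orbT.
  have -> : (N.+1)`!%:R * (2 * s * k ^+ 2) = s * c / 2 by rewrite /c; field.
  lra.
pose K := cover_mass delta b * (k `^ t * s `^ (- t) + 1).
have K0 : 0 < K.
  by rewrite mulr_gt0 ?cover_mass_gt0// ltr_wpDl // mulr_ge0 ?powR_ge0.
have aN : 0 < a ^+ N by rewrite exprn_gt0.
pose eps := a ^+ N / (2 * K).
have eps0 : 0 < eps by rewrite divr_gt0 // mulr_gt0.
have epsK : K * eps < a ^+ N.
  have -> : K * eps = a ^+ N / 2 by rewrite /eps; field; rewrite gt_eqF.
  lra.
have : (haus_content (@distCN R N) t s (BadC i `&` Omega) < eps%:E)%E.
  by apply: le_lt_trans (Ht s s0) _; rewrite lte_fin.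
move=> /ereal_inf_lt[_ [F [cov Fs] <-]]; apply/negP; rewrite -leNgt.
exact: (cover_sum_ge k2 kN s0 sr0 i0 i1 small m_fin m_Om cOm r0_gt0 a_gt0 b_gt0
  condA_lb condA_ub k_large O0 s3 t0 k_loss cov Fs eps0 epsK).
Qed.

End Dimension.

(** * Uniform constants and the equality of dimensions *)

Lemma exists_pos_lower_bound (R : realType) N (f : 'I_N -> R) :
  (forall j, 0 < f j) -> exists2 e, 0 < e & forall j, e <= f j.
Proof.
move=> f0; have s0 : 0 <= \sum_j (f j)^-1 by apply: sumr_ge0 => j _; rewrite invr_ge0 ltW.
have s1 : 0 < 1 + \sum_j (f j)^-1 by rewrite ltr_pwDl.
(* The added 1 keeps the sum positive when [N] is 0. *)
exists (1 + \sum_j (f j)^-1)^-1; first by rewrite invr_gt0.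
move=> j; rewrite -[leRHS]invrK lef_pV2 ?posrE ?invr_gt0// (bigD1 j) //= addrCA lerDl.
by rewrite addr_ge0 // sumr_ge0 // => l _; rewrite invr_ge0 ltW.
Qed.

Theorem theorem9 (R : realType) (N : nat) (Om : 'I_N -> set (C R))
    (m : 'I_N -> {measure set (C R) -> \bar R}) (delta : 'I_N -> R)
    (i : 'I_N -> R) :
  (forall j, compact (Om j)) ->
  (forall j, (m j setT < +oo)%E) ->
  (forall j (x : C R), m j [set x] = 0%E) ->
  (forall j, m j (~` Om j) = 0%E) ->
  (forall j, condA (m j) (Om j) (delta j)) ->
  (forall j, 0 <= i j) ->
  \sum_(j < N) i j = 1 ->
  let Omega := [set z : 'I_N -> C R | forall j, Om j (z j)] in
  hausdorff_dim (@distCN R N) (BadC i `&` Omega) = hausdorff_dim (@distCN R N) Omega.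
Proof.
move=> cOm m_fin m_atom m_Om hA i0 i1 Omega.
have [ne|em] := EM (Omega !=set0); last first.
  congr hausdorff_dim; apply/seteqP; split=> [z []//|z Oz].
  by exfalso; apply: em; exists z.
pose P (j : 'I_N) (v : R * R * R) := [/\ 0 < v.1.1, 0 < v.1.2, 0 < v.2 &
  forall c r, Om j c -> 0 < r -> r <= v.1.1 ->
    ((v.1.2 * r `^ delta j)%:E <= m j (cball c r))%E /\
    (m j (cball c r) <= (v.2 * r `^ delta j)%:E)%E].
have [v hv] : {v : 'I_N -> R * R * R & forall j, P j (v j)}.
  apply: choice => j; have [r0 [a [b [r00 a0 _ b1 h]]]] := hA j.
  by exists (r0, a, b); split => //=; exact: lt_le_trans b1.
have [ |r0 r00 r0_le] := @exists_pos_lower_bound R N (fun j => (v j).1.1).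
  by move=> j; have [] := hv j.
have [ |a a0 a_le] := @exists_pos_lower_bound R N (fun j => (v j).1.2).
  by move=> j; have [] := hv j.
(* A common upper constant is the inverse of a lower bound for the reciprocals. *)
have [ |b' b'0 b_le] := @exists_pos_lower_bound R N (fun j => (v j).2^-1).
  by move=> j; rewrite invr_gt0; have [] := hv j.
have b0 : 0 < b'^-1 by rewrite invr_gt0.
have condA_lb j c r : Om j c -> 0 < r -> r <= r0 -> ((a * r `^ delta j)%:E <= m j (cball c r))%E.
  move=> Oc rp rr; have [_ _ _ /(_ c r Oc rp (le_trans rr (r0_le j)))[h _]] := hv j.
  by apply: le_trans h; rewrite lee_fin ler_wpM2r ?powR_ge0.
have condA_ub j c r : Om j c -> 0 < r -> r <= r0 -> (m j (cball c r) <= (b'^-1 * r `^ delta j)%:E)%E.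
  move=> Oc rp rr; have [_ _ b0' /(_ c r Oc rp (le_trans rr (r0_le j)))[_ h]] := hv j.
  apply: le_trans h _; rewrite lee_fin ler_wpM2r ?powR_ge0//.
  by rewrite -[leLHS]invrK lef_pV2 ?posrE ?invr_gt0.
have delta_gt0 j : 0 < delta j.
  have [z Oz] := ne; have Oj : Om j !=set0 by exists (z j).
  exact: (exponent_gt0 (m_fin j) r00 a0 (@condA_lb j) Oj (m_atom j)).
(* One inequality is monotonicity; for the other, [\sum_j delta j] lies between the two
   dimensions. *)
apply/eqP; rewrite eq_le; apply/andP; split.
  by apply: hausdorff_dim_le => z [].
apply: le_trans (hausdorff_dim_product_le m_fin r00 a0 condA_lb delta_gt0) _.
exact: (hausdorff_dim_Bad_ge m_fin m_Om cOm r00 a0 b0 condA_lb condA_ub delta_gt0 i0 i1 ne).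
Qed.
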